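(* Let $(\Omega,\mathcal F,\mu,\{\mathcal F_n\}_{n\ge 0})$ be a filtered probability space, let $1<p<\infty$, and let $w$ be a weight with $w\in A_p$. Let $f\in L^1(\mu)$ and let $Tf$ be its martingale transform corresponding to an adapted multiplier sequence $v=(v_n)_{n\ge0}$ with $\sup_n\|v_n\|_\infty\le1$. Then $$\|Tf\|_{L^p(w)}\le C\,[w]_{A_p}^{\max\{1,\frac1{p-1}\}}\,\|f\|_{L^p(w)},$$ where the constant $C$ depends only on $p$ (not on $w$, $f$ or $v$). The same inequality holds for $M(Tf)$ in place of $Tf$.
   Context: Filtered probability space: $(\Omega,\mathcal F,\mu)$ is a complete probability space, $\{\mathcal F_n\}_{n\ge0}$ is an increasing sequence of sub-$\sigma$-algebras of $\mathcal F$, each $(\Omega,\mathcal F_n,\mu)$ is complete, and $\mathcal F$ is the $\sigma$-algebra generated by $\bigcup_n\mathcal F_n$. Martingale transform: for $f\in L^1(\mu)$ put $f_n=\mathbb E(f\mid\mathcal F_n)$, $\Delta_n f=f_n-f_{n-1}$ for $n\ge1$. For an adapted sequence $v=(v_n)_{n\ge0}$ ($v_n$ is $\mathcal F_n$-measurable) that is uniformly bounded, $(Tf)_0=0$, $(Tf)_n=\sum_{k=1}^n v_{k-1}\Delta_k f$ for $n\ge 1$, and $Tf=\sum_{n=1}^\infty v_{n-1}\Delta_n f=\lim_n (Tf)_n$ (the limit exists a.e.). The maximal function is $M(Tf)=\sup_{n\ge0}|(Tf)_n|$. Weights: a weight $w$ is a positive random variable in $L^1(\mu)$; $\|f\|_{L^p(w)}=(\int_\Omega|f|^pw\,d\mu)^{1/p}$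 (possibly $+\infty$). With $\sigma=w^{-1/(p-1)}$ assumed to be in $L^1$ and $g_n=\mathbb E(g\mid\mathcal F_n)$, $[w]_{A_p}=\sup_{n\ge0}\|w_n\,(\sigma_n)^{p-1}\|_\infty$, and $w\in A_p$ means $[w]_{A_p}<\infty$. *)

(* Defs.v *)
From HB Require Import structures.
From mathcomp Require Import all_boot all_order all_algebra.
From mathcomp Require Import all_classical all_reals all_analysis.
From mathcomp Require Import measurable_realfun.

Set Implicit Arguments.
Unset Strict Implicit.
Unset Printing Implicit Defensive.

Import Order.TTheory GRing.Theory Num.Theory.
Import numFieldNormedType.Exports.

Local Open Scope classical_set_scope.
Local Open Scope ring_scope.

Section conditional_expectation.
Context {R : realType} {d : measure_display} {T : measurableType d}.
Variable P : probability T R.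
Implicit Types (G : set (set T)) (f g : T -> R).

(* Here and below a sub-sigma-algebra is a set of sets [G] with
   [sigma_algebra setT G] and [G `<=` measurable]. *)
Definition measurable_wrt G g : Prop :=
  forall B : set R, measurable B -> G (g @^-1` B).

Definition is_cond_exp G f g : Prop :=
  [/\ measurable_wrt G g,
      P.-integrable setT (EFin \o g) &
      forall A, G A ->
        (\int[P]_(x in A) (g x)%:E = \int[P]_(x in A) (f x)%:E)%E].

(* A chosen version of E(f | G); a version exists whenever [f] is integrable,
   see [cond_expP]. *)
Definition cond_exp G f : T -> R := xget (cst 0) [set g | is_cond_exp G f g].

Lemma cond_expP G f : sigma_algebra setT G -> G `<=` measurable ->
  P.-integrable setT (EFin \o f) -> is_cond_exp G f (cond_exp G f).
Proof.
move=> sG Gm intf.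
suff: exists g, is_cond_exp G f g by exact: (@xgetPex _ _ [set g | _]).
have mG A : @measurable _ (g_sigma_algebraType G) A = G A.
  by rewrite /measurable/= sigma_algebra_id.
pose i : T -> g_sigma_algebraType G := fun x => x.
have mi : measurable_fun setT i.
  by move=> _ B; rewrite mG setTI => /Gm.
pose X : {RV P >-> g_sigma_algebraType G} := mfun_Sub (mem_set mi).
pose mu := distribution P X.
pose nu : {charge set (g_sigma_algebraType G) -> \bar R} :=
  measure_function_pushforward__canonical__charge_Charge
    (induced_charge intf) mi.
have numu : nu `<< mu.
  apply: dominates_pushforward => //.
  apply/null_content_dominatesP => /= A mA PA0.
  rewrite /induced_charge; apply: null_set_integral => //.
  exact/measurable_funTS/(measurable_int P intf).
have [h [hfin hint hE]] : exists h : g_sigma_algebraType G -> \bar R,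
    [/\ forall x, h x \is a fin_num, mu.-integrable setT h &
        forall A, measurable A -> nu A = (\int[mu]_(x in A) h x)%E].
  exists (Radon_Nikodym nu mu); split => [x||A mA].
  - exact: Radon_Nikodym_fin_num.
  - exact: Radon_Nikodym_integrable.
  - exact: Radon_Nikodym_integral.
have mh := measurable_int mu hint.
have hPint : P.-integrable setT (fun x : T => h (X x)).
  apply/integrableP; split; first exact: measurableT_comp.
  move/integrableP : hint => [_]; rewrite ge0_integral_pushforward//.
  exact: measurableT_comp.
have fh x : (fine (h x))%:E = h x by rewrite fineK.
exists (fun x => fine (h x)); split => /=.
- move=> B mB; rewrite -mG -[X in measurable X]setTI.
  have mfh : measurable_fun setT (fine \o h) by exact: measurableT_comp.
  exact: mfh.
- by apply: eq_integrable hPint => // x _; rewrite /= fh.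
- move=> A GA; have mA : @measurable _ (g_sigma_algebraType G) A by rewrite mG.
  under eq_integral do rewrite fh.
  transitivity (nu A) => //.
  rewrite hE// integral_pushforward//.
  by apply: integrableS hPint => //; exact: Gm.
Qed.

End conditional_expectation.

Section filtered_space.
Context {R : realType} {d : measure_display} {T : measurableType d}.
Variables (P : probability T R) (F : nat -> set (set T)).

Definition filtered_probability_space : Prop :=
  [/\ measure_is_complete P,
      (forall n, sigma_algebra setT (F n)) /\ (forall n, F n `<=` measurable),
      forall m n, (m <= n)%N -> F m `<=` F n,
      forall n A N, F n A -> P A = 0%E -> N `<=` A -> F n N &
      @measurable d T = <<s \bigcup_n F n >>].

Definition adapted (v : nat -> T -> R) : Prop :=
  forall n, measurable_wrt (F n) (v n).

Definition martingale_diff (f : T -> R) (n : nat) (x : T) : R :=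
  cond_exp P (F n) f x - cond_exp P (F n.-1) f x.

Definition transform_n (v : nat -> T -> R) (f : T -> R) (n : nat) (x : T) : R :=
  \sum_(1 <= k < n.+1) v k.-1 x * martingale_diff f k x.

(* For bounded adapted [v] and integrable [f] the limit exists almost
   everywhere; on the exceptional null set [limn] is a default value. *)
Definition transform (v : nat -> T -> R) (f : T -> R) (x : T) : R :=
  limn (fun n => transform_n v f n x).

Definition transform_max (v : nat -> T -> R) (f : T -> R) (x : T) : \bar R :=
  ereal_sup (range (fun n => `|transform_n v f n x|%:E)).

Definition is_weight (w : T -> R) : Prop :=
  (forall x, 0 < w x) /\ P.-integrable setT (EFin \o w).

(* [g] is extended-real valued because the maximal function may be infinite. *)
Definition wLnorm (p : R) (w : T -> R) (g : T -> \bar R) : \bar R :=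
  ((\int[P]_x (`|g x| `^ p * (w x)%:E)) `^ (p^-1)%R)%E.

Definition dual_weight (p : R) (w : T -> R) (x : T) : R :=
  w x `^ (- (p - 1)^-1).

Definition Ap_const (p : R) (w : T -> R) : \bar R :=
  ereal_sup (range (fun n => Lnorm P +oo%E (fun x =>
    (cond_exp P (F n) w x
       * cond_exp P (F n) (dual_weight p w) x `^ (p - 1))%:E))).

Definition in_Ap (p : R) (w : T -> R) : Prop :=
  P.-integrable setT (EFin \o dual_weight p w) /\ (Ap_const p w < +oo)%E.

End filtered_space.

(* Main.v *)
Require Import Defs.
From HB Require Import structures.
From mathcomp Require Import all_boot all_order all_algebra.
From mathcomp Require Import all_classical all_reals all_analysis.
From mathcomp Require Import measurable_realfun ess_sup_inf.
From mathcomp Require Import ring lra.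
Set Implicit Arguments.
Unset Strict Implicit.
Unset Printing Implicit Defensive.
Import Order.TTheory GRing.Theory Num.Theory.
Import numFieldNormedType.Exports.
Local Open Scope classical_set_scope.
Local Open Scope ring_scope.

(** Since [Tf] is bounded pointwise by the maximal function, only the latter has
    to be estimated, and by monotone convergence only up to a finite time [N].

    Put [h = |f| + eps]. Stopping each time [Tf] or the martingale [h_n] has moved
    by more than [8] times the value of [h] at the previous stop gives the pathwise
    bound [|(Tf)_n| <= 18 * \sum_i 1_{J_i} h_i], where [J_i] is the event of a stop
    at time [i]. By a conditional weak (1,1) inequality, obtained pathwise from
    Burkholder's function, the conditional probability of a further stop after one
    at time [i] is at most [1/2].

    For the weighted bound of this sparse sum, with [sigma] the dual weight, write
    [h_i (g w)_i = H_i G_i sigma_i w_i], where [H_i] and [G_i] are conditional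
    expectations of [h / sigma] and [g] for the measures [sigma dP] and [w dP]. The
    [A_p] condition gives [sigma_i w_i <= K * rho_i ^ (- s)] with [s >= 0], where
    [rho = sigma] if [p >= 2] and [rho = w] if [p < 2], and in both cases
    [rho ^ (- s) = sigma ^ (1 / p) * w ^ (1 / q)]. On a quarter of [J_i], in the
    conditional sense, there is no later stop and [rho <= 4 rho_i], so [rho_i] may
    be replaced by [rho]; as these sets are disjoint, Young's inequality and Doob's
    inequality for [H] and [G] bound the sum. Choosing [g] as the truncated
    [(p-1)]-st power of the sparse sum closes the estimate. *)

(** * Burkholder's function and its tangent inequality *)

Section burkholder_function.
Context {R : realType}.
Implicit Types l x y h k : R.

(** Burkholder's special function for the weak type (1,1) inequality, rescaled to the level [l]. It
    lies above [l 1_{|y| > l} - 2|x|] and is at most [0] on the axis [y = 0]. *)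
Definition burk l x y : R :=
  if `|x| + `|y| <= l then (y ^+ 2 - x ^+ 2) / l else l - 2 * `|x|.

(** The partial derivatives of [burk] on either side of [|x| + |y| = l]; on the outer kink [x = 0]
    the value [Num.sg 0 = 0] selects a supergradient of [- 2|x|]. *)
Definition burk_dx l x y : R :=
  if `|x| + `|y| <= l then - (2 * x) / l else - (2 * Num.sg x).

Definition burk_dy l x y : R :=
  if `|x| + `|y| <= l then 2 * y / l else 0.

Lemma burk_dx_le l x y : 0 < l -> `|burk_dx l x y| <= 2.
Proof.
move=> l0; rewrite /burk_dx; case: ifPn => [xy|_].
  rewrite normrM normrN normfV (gtr0_norm l0) ler_pdivrMr// normrM ger0_norm//.
  by have := normr_ge0 y; lra.
by rewrite normrN normrM ger0_norm// normr_sg; case: (x != 0) => /=; lra.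
Qed.

Lemma burk_dy_le l x y : 0 < l -> `|burk_dy l x y| <= 2.
Proof.
move=> l0; rewrite /burk_dy; case: ifPn => [xy|_]; last by rewrite normr0.
rewrite normrM normfV (gtr0_norm l0) ler_pdivrMr// normrM ger0_norm//.
by have := normr_ge0 x; lra.
Qed.

(** Inside the diamond [|y| <= l - |x|], and squaring this gives the claim; outside there is
    equality. *)
Lemma burk_le l x y : 0 < l -> burk l x y <= l - 2 * `|x|.
Proof.
move=> l0; rewrite /burk; case: ifPn => // xy.
rewrite ler_pdivrMr// -(real_normK (num_real x)) -(real_normK (num_real y)).
by have := normr_ge0 x; have := normr_ge0 y; nra.
Qed.

Lemma burk_ge l x y : 0 < l ->
  (if l < `|y| then l else 0) - 2 * `|x| <= burk l x y.
Proof.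
move=> l0; rewrite /burk; have x0 := normr_ge0 x; have y0 := normr_ge0 y.
case: ifPn => [ly|ly]; case: ifPn => [xy|xy] //; try lra.
rewrite ler_pdivlMr// -(real_normK (num_real x)) -(real_normK (num_real y)).
by nra.
Qed.

Lemma burk_x0_le0 l x : 0 < l -> burk l x 0 <= 0.
Proof.
move=> l0; rewrite /burk normr0 addr0; case: ifPn => [xy|xy]; last lra.
by rewrite expr0n/= sub0r mulNr oppr_le0 divr_ge0 ?sqr_ge0// ltW.
Qed.

Lemma sgrM_le (x z : R) : Num.sg x * z <= `|z|.
Proof.
rewrite (le_trans (ler_norm _))// normrM normr_sg.
by case: (x != 0); rewrite ?mul1r// mul0r.
Qed.

(** Completing squares, the claim is [(1 - |x + h|)^2 <= (y + k)^2 + h^2 - k^2]. If [|x + h| <= 1],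
    leaving the diamond means [1 - |x + h| < |y + k|]. Otherwise [|x + h| - 1 <= |h| - |y|], whose
    square is at most [h^2 + 2 y k + y^2]. *)
Lemma burk_step_unit x y h k : `|k| <= `|h| -> `|x| + `|y| <= 1 ->
  1 < `|x + h| + `|y + k| ->
  1 - 2 * `|x + h| <= y ^+ 2 - x ^+ 2 - 2 * x * h + 2 * y * k.
Proof.
wlog x0 : x h / 0 <= x => [wl|].
  have [x0|/ltW x0] := leP 0 x; first exact: wl.
  move=> kh xy xy1; have := wl (- x) (- h).
  rewrite oppr_ge0 !normrN -opprD normrN => /(_ x0 kh xy xy1).
  by rewrite sqrrN; lra.
wlog y0 : y k / 0 <= y => [wl|].
  have [y0|/ltW y0] := leP 0 y; first exact: wl.
  move=> kh xy xy1; have := wl (- y) (- k).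
  rewrite oppr_ge0 !normrN -opprD normrN => /(_ y0 kh xy xy1).
  by rewrite sqrrN; lra.
rewrite (ger0_norm x0) (ger0_norm y0).
case: (ger0P h) => h0; case: (ger0P k) => k0;
  case: (ger0P (x + h)) => xh; case: (ger0P (y + k)) => yk kh xy xy1; try nra.
Qed.

(** Three cases. From a point outside the diamond, [burk_le] and the concavity of [- 2|x|] suffice;
    a step staying inside has the error [(k^2 - h^2) / l <= 0]; a step leaving the diamond is
    rescaled to [burk_step_unit]. *)
Lemma burk_step l x y h k : 0 < l -> `|k| <= `|h| ->
  burk l (x + h) (y + k) <= burk l x y + burk_dx l x y * h + burk_dy l x y * k.
Proof.
move=> l0 kh.
have [xy|xy] := leP (`|x| + `|y|) l; last first.
  apply: (le_trans (burk_le _ _ l0)).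
  have {}xy : (`|x| + `|y| <= l) = false by rewrite leNgt xy.
  rewrite /burk /burk_dx /burk_dy xy mul0r addr0.
  have := sgrM_le x (x + h); have : Num.sg x * x = `|x| by rewrite -normrEsg.
  lra.
rewrite {2}/burk /burk_dx /burk_dy xy.
have hk2 : k ^+ 2 <= h ^+ 2.
  by rewrite -(real_normK (num_real h)) -(real_normK (num_real k)) lerXn2r ?nnegrE.
have l1 : l * l^-1 = 1 by rewrite divff// gt_eqF.
have [xyhk|xyhk] := leP (`|x + h| + `|y + k|) l.
  rewrite /burk xyhk [leRHS](_ : _ =
    (y ^+ 2 - x ^+ 2 - 2 * x * h + 2 * y * k) / l); last by ring.
  by rewrite ler_pM2r ?invr_gt0//; nra.
have xyhkF : (`|x + h| + `|y + k| <= l) = false by rewrite leNgt xyhk.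
rewrite /burk xyhkF.
have V z : `|z / l| = `|z| / l by rewrite normrM normfV (gtr0_norm l0).
have := @burk_step_unit (x / l) (y / l) (h / l) (k / l).
rewrite -!mulrDl !V ler_pM2r ?invr_gt0// -mulrDl ler_pdivrMr// mul1r.
rewrite -mulrDl ltr_pdivlMr// mul1r => /(_ kh xy xyhk) H.
rewrite -(ler_pM2l (_ : 0 < l^-1)) ?invr_gt0//.
have -> : l^-1 * (l - 2 * `|x + h|) = 1 - 2 * (`|x + h| / l) by rewrite -l1; ring.
by apply: le_trans H _; rewrite le_eqVlt; apply/orP; left; apply/eqP; ring.
Qed.

End burkholder_function.

(** * A pathwise weak type inequality for transforms *)

Section pathwise_transform.
Context {R : realType}.
Variables (l : R) (x v : nat -> R).
Hypotheses (l0 : 0 < l) (v1 : forall n, `|v n| <= 1).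

(* The transform of [x] by [v], frozen once its modulus exceeds [l]. *)
Fixpoint stopped_transform n : R :=
  if n is m.+1 then
    let y := stopped_transform m in
    if `|y| <= l then y + v m * (x m.+1 - x m) else y
  else 0.

Definition stopped_mult n : R := if `|stopped_transform n| <= l then v n else 0.

(** The coefficient of the increment of [x] in the tangent inequality, the increment of the stopped
    transform being [stopped_mult n] times it. It depends only on [x] and [v] up to time [n], so for
    a martingale the resulting sums have mean zero. *)
Definition burk_coef n : R :=
  burk_dx l (x n) (stopped_transform n)
  + burk_dy l (x n) (stopped_transform n) * stopped_mult n.

Lemma stopped_mult_le1 n : `|stopped_mult n| <= 1.
Proof. by rewrite /stopped_mult; case: ifP; rewrite ?normr0. Qed.

Lemma stopped_transformS n : stopped_transform n.+1 =
  stopped_transform n + stopped_mult n * (x n.+1 - x n).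
Proof. by rewrite /= /stopped_mult; case: ifP; rewrite ?mul0r ?addr0. Qed.

Lemma burk_coef_le n : `|burk_coef n| <= 4.
Proof.
rewrite (le_trans (ler_normD _ _))// normrM.
have := burk_dx_le (x n) (stopped_transform n) l0.
have := burk_dy_le (x n) (stopped_transform n) l0.
have := stopped_mult_le1 n.
have := normr_ge0 (burk_dy l (x n) (stopped_transform n)).
have := normr_ge0 (stopped_mult n).
nra.
Qed.

(** Induction with [burk_step], starting from [burk l (x 0) 0 <= 0]; multipliers of modulus at most
    [1] supply its hypothesis [|k| <= |h|]. *)
Lemma burk_path n : burk l (x n) (stopped_transform n) <=
  \sum_(i < n) burk_coef i * (x i.+1 - x i).
Proof.
elim: n => [|n IH]; first by rewrite big_ord0; exact: burk_x0_le0.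
rewrite big_ord_recr/=.
have /= := @burk_step _ l (x n) (stopped_transform n) (x n.+1 - x n)
  (stopped_mult n * (x n.+1 - x n)) l0.
rewrite subrKC -stopped_transformS normrM ler_piMl ?stopped_mult_le1// => /(_ isT).
move: IH; rewrite /burk_coef; set s := \sum_(i < n) _; lra.
Qed.

(** The majorization [burk_ge] turns [burk_path] into a weak type estimate, up to a sum that
    integrates to zero for a martingale. *)
Lemma stopped_transform_gt n : (if l < `|stopped_transform n| then l else 0) <=
  2 * `|x n| + \sum_(i < n) burk_coef i * (x i.+1 - x i).
Proof.
have := burk_path n; have := burk_ge (x n) (stopped_transform n) l0.
set s := \sum_(i < n) _; lra.
Qed.

Lemma stopped_transformP n :
  stopped_transform n = \sum_(i < n) v i * (x i.+1 - x i) \/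
  l < `|stopped_transform n|.
Proof.
elim: n => [|n IH]; first by left; rewrite big_ord0.
rewrite big_ord_recr/=; case: ifPn => [yl|]; last by rewrite -ltNge; right.
by left; case: IH => [->//|]; rewrite ltNge yl.
Qed.

Lemma stopped_transform_max n j : (j <= n)%N ->
  l < `|\sum_(i < j) v i * (x i.+1 - x i)| -> l < `|stopped_transform n|.
Proof.
move=> jn lj; have {lj} : l < `|stopped_transform j|.
  by case: (stopped_transformP j) => [->|].
elim: n jn => [|n IH]; first by rewrite leqn0 => /eqP ->.
rewrite leq_eqVlt => /predU1P[->//|jn /(IH jn) lj].
by rewrite /= leNgt lj.
Qed.

End pathwise_transform.

(** * The stopping rule and pathwise sparse domination *)

Section pathwise_sparse.
Context {R : realType}.
Variables (c : R) (t h : nat -> R).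
Hypotheses (c1 : 1 <= c).

(* The pair [(h m, t m)] for the last stopping index [m <= n], where [0] is a
   stopping index and a new one is created as soon as [t] or [h] moves by more
   than [c * h m]. *)
Fixpoint stop_state n : R * R :=
  if n is m.+1 then
    let s := stop_state m in
    if (c * s.1 < `|t m.+1 - s.2|) || (c * s.1 < `|h m.+1 - s.1|)
    then (h m.+1, t m.+1) else s
  else (h 0%N, t 0%N).

Definition stops n : bool :=
  if n is m.+1 then
    (c * (stop_state m).1 < `|t m.+1 - (stop_state m).2|)
    || (c * (stop_state m).1 < `|h m.+1 - (stop_state m).1|)
  else true.

Arguments stops : simpl never.

Lemma stop_stateS n : stop_state n.+1 =
  if stops n.+1 then (h n.+1, t n.+1) else stop_state n.
Proof. by []. Qed.

Lemma stop_state_stops n : stops n -> stop_state n = (h n, t n).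
Proof. by case: n => [//|n] sn; rewrite stop_stateS sn. Qed.

Fixpoint stops_in n k : bool :=
  if k is j.+1 then stops_in n j || stops (n + j.+1) else false.

Lemma stop_state_add n k : ~~ stops_in n k -> stop_state (n + k) = stop_state n.
Proof.
elim: k => [|k IH]; first by rewrite addn0.
by rewrite [stops_in _ _]/= negb_or => /andP[/IH <- ns]; rewrite addnS in ns *;
   rewrite stop_stateS (negbTE ns).
Qed.

(** Until the first stop after [n] the reference values remain those of time [n], so that stop is an
    excursion measured from [n]. *)
Lemma stops_inP n k : stops n -> stops_in n k -> exists2 j, (j <= k)%N &
  c * h n < `|t (n + j) - t n| \/ c * h n < `|h (n + j) - h n|.
Proof.
move=> sn; elim: k => [//|k IH].
have [/IH[j jk H] _|nk] := boolP (stops_in n k); first by exists j => //; exact: leqW.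
rewrite [stops_in _ _]/= (negbTE nk)/= => H; exists k.+1 => //.
move: H; rewrite addnS /stops stop_state_add// stop_state_stops// => /orP.
by [].
Qed.

(** Exactly one index up to [n] is the last stop, so at most one term is nonzero. In the induction a
    stop at [n.+1] cancels all earlier terms; otherwise the new term is zero. *)
Lemma sum_last_stop (z : nat -> R) (B : R) n : (forall i, (i <= n)%N -> z i <= B) ->
  \sum_(i < n.+1) (if stops i && ~~ stops_in i (n - i) then z i else 0) <= B.
Proof.
elim: n => [|n IH] zB; first by rewrite big_ord_recl big_ord0/= addr0; exact: zB.
have inS i : (i <= n)%N -> stops_in i (n.+1 - i) = stops_in i (n - i) || stops n.+1.
  by move=> ni; rewrite subSn//= addnS subnKC.
rewrite big_ord_recr/= subnn andbT.
have [sn|sn] := boolP (stops n.+1).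
  rewrite big1 ?add0r; first exact: zB.
  by move=> i _; rewrite inS ?sn ?orbT ?andbF// -ltnS.
rewrite addr0 (le_trans _ (IH _))//; last first.
  by move=> i ni; exact/zB/leqW.
rewrite le_eqVlt; apply/orP; left; apply/eqP/eq_bigr => i _.
by rewrite inS ?(negbTE sn) ?orbF// -ltnS.
Qed.

Lemma sparse_domination n : t 0%N = 0 ->
  (forall i, 0 <= h i) ->
  (forall i, `|t i.+1 - t i| <= h i.+1 + h i) ->
  `|t n| <= (2 * c + 2) * \sum_(i < n.+1) (if stops i then h i else 0).
Proof.
move=> t0 hp ht.
have hc i : h i <= c * h i by rewrite ler_peMl.
(* The surplus [2 * c + 1] times the last stopped [h] pays for the next stop: since the last one [t]
   has drifted by at most [c] times this value, and the final jump costs at most [c + 1] times it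
   plus [h m.+1]. The new term of the sum covers [h m.+1] and the new surplus. *)
have inv m : `|(stop_state m).2| + (2 * c + 1) * (stop_state m).1 <=
    (2 * c + 2) * \sum_(i < m.+1) (if stops i then h i else 0) /\
    `|t m - (stop_state m).2| <= c * (stop_state m).1 /\
    h m <= (c + 1) * (stop_state m).1 /\ 0 <= (stop_state m).1.
  elim: m => [|m [H1 [H2 [H3 H4]]]].
    rewrite big_ord_recl big_ord0 /stops/= t0 subrr normr0.
    by have := hp 0%N; have := hc 0%N; repeat split; lra.
  rewrite big_ord_recr stop_stateS; set s := \sum_(i < m.+1) _ in H1 *.
  have [sm|sm] := boolP (stops m.+1) => /=.
    rewrite subrr normr0; have := hp m.+1; have := hc m.+1; have := ht m; repeat split; try lra.
    have : `|t m.+1| <= `|t m.+1 - t m| + `|t m - (stop_state m).2| + `|(stop_state m).2|.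
      rewrite -[X in `|X| <= _](subrK (t m)) (le_trans (ler_normD _ _))// -addrA lerD2l.
      by rewrite -[X in `|X| <= _](subrK (stop_state m).2) ler_normD.
    by lra.
  move: sm => /[dup] sm; rewrite /stops negb_or -!leNgt => /andP[s1 s2].
  rewrite addr0; repeat split => //.
  by have := ler_norm (h m.+1 - (stop_state m).1); lra.
have [H1 [H2 [H3 H4]]] := inv n; apply: le_trans H1.
rewrite -[X in `|X| <= _](subrK (stop_state n).2) (le_trans (ler_normD _ _))//.
by have := mulr_ge0 (le_trans ler01 c1) H4; lra.
Qed.

End pathwise_sparse.

(* Measurability with respect to the sub-sigma-algebra [G]. *)
Local Notation gmeas G f :=
  (@measurable_fun _ _ (g_sigma_algebraType G) _ [set: _] f).

(** * Measurability with respect to sub-sigma-algebras *)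

Section sub_sigma_algebra.
Context {R : realType} {d : measure_display} {T : measurableType d}.
Implicit Types (G H : set (set T)).

Lemma gmeasE G (A : set T) : sigma_algebra setT G ->
  @measurable _ (g_sigma_algebraType G) A = G A.
Proof. by move=> sG; rewrite /measurable/= sigma_algebra_id. Qed.

Lemma measurable_wrtP G (g : T -> R) : sigma_algebra setT G ->
  measurable_wrt G g <-> gmeas G g.
Proof.
move=> sG; split => [mg _ B mB|mg B mB]; first by rewrite setTI gmeasE//; exact: mg.
by rewrite -gmeasE// -[X in measurable X]setTI; exact: mg.
Qed.

Lemma gmeas_sub G H d' (U : measurableType d') (g : T -> U) :
  sigma_algebra setT G -> sigma_algebra setT H -> G `<=` H ->
  gmeas G g -> gmeas H g.
Proof.
move=> sG sH GH mg _ B mB; have := mg measurableT _ mB.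
by rewrite setTI !gmeasE//; exact: GH.
Qed.

Lemma gmeas_measurable G d' (U : measurableType d') (g : T -> U) :
  sigma_algebra setT G -> G `<=` measurable -> gmeas G g -> measurable_fun setT g.
Proof.
move=> sG GH mg _ B mB; have := mg measurableT _ mB.
by rewrite setTI gmeasE//; exact: GH.
Qed.

Lemma gmeas_bool G (b : T -> bool) : sigma_algebra setT G ->
  gmeas G b -> G [set x | b x].
Proof.
move=> sG mb; rewrite -gmeasE//; have := mb measurableT [set true].
by rewrite setTI; exact.
Qed.

End sub_sigma_algebra.

(** * Integrals of real-valued functions on a probability space *)

Section integrals.
Context {R : realType} {d : measure_display} {T : measurableType d}.
Variable P : probability T R.
Local Notation I f := (\int[P]_x (f x)%:E)%E.
Implicit Types f g u : T -> R.

Lemma integrable_bounded_mul (a : T -> R) (C : R) f : measurable_fun setT a ->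
  (forall x, `|a x| <= C) -> P.-integrable setT (EFin \o f) ->
  P.-integrable setT (EFin \o (fun x => a x * f x)).
Proof.
move=> ma aC If; have := @integrableMr _ _ _ P setT measurableT a (EFin \o f) ma.
apply => //; exists C; split; first exact: num_real.
by move=> M CM x _ /=; rewrite (le_trans (aC x))// ltW.
Qed.

Lemma bounded_fun_integrable (a : T -> R) (C : R) : measurable_fun setT a ->
  (forall x, `|a x| <= C) -> P.-integrable setT (EFin \o a).
Proof.
move=> ma aC; have := @integrable_bounded_mul a C (cst 1) ma aC.
have -> : (fun x => a x * cst 1 x) = a by apply/funext => x; rewrite /= mulr1.
by apply; exact: finite_measure_integrable_cst.
Qed.

Lemma ge0_integral_le f g : measurable_fun setT f -> measurable_fun setT g ->
  (forall x, 0 <= f x) -> (forall x, 0 <= g x) ->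
  (\forall x \ae P, f x <= g x) -> (I f <= I g)%E.
Proof.
move=> mf mg f0 g0 fg; apply: ae_ge0_le_integral => //.
- by move=> x _; rewrite lee_fin.
- exact/measurable_EFinP.
- by move=> x _; rewrite lee_fin.
- exact/measurable_EFinP.
- by apply: filterS fg => x fgx _; rewrite lee_fin.
Qed.

Lemma ge0_integral_mulr k f : measurable_fun setT f -> (forall x, 0 <= f x) ->
  0 <= k -> (\int[P]_x (k * f x)%:E = k%:E * I f)%E.
Proof.
move=> mf f0 k0; under eq_integral do rewrite EFinM.
rewrite ge0_integralZl_EFin//; last exact/measurable_EFinP.
by move=> x _; rewrite lee_fin.
Qed.

Lemma ge0_integral_add f g : measurable_fun setT f -> measurable_fun setT g ->
  (forall x, 0 <= f x) -> (forall x, 0 <= g x) ->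
  (\int[P]_x (f x + g x)%:E = I f + I g)%E.
Proof.
move=> mf mg f0 g0; under eq_integral do rewrite EFinD.
rewrite ge0_integralD//; try exact/measurable_EFinP; by move=> x _; rewrite lee_fin.
Qed.

Lemma ge0_integral_sumr n (f : 'I_n -> T -> R) :
  (forall i, measurable_fun setT (f i)) -> (forall i x, 0 <= f i x) ->
  (\int[P]_x (\sum_(i < n) f i x)%:E = \sum_(i < n) I (f i))%E.
Proof.
move=> mf f0; under eq_integral do rewrite -sumEFin.
rewrite ge0_integral_sum// => i; first exact/measurable_EFinP.
by move=> x _; rewrite lee_fin.
Qed.

(* Monotone convergence along the truncations [min f k]. *)
Lemma integral_min_le (b : T -> R) f (r : R) (B : \bar R) :
  measurable_fun setT b -> measurable_fun setT f ->
  (forall x, 0 <= b x) -> (forall x, 0 <= f x) -> 0 <= r ->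
  (forall k : nat, \int[P]_x (Num.min (f x) k%:R `^ r * b x)%:E <= B)%E ->
  (\int[P]_x (f x `^ r * b x)%:E <= B)%E.
Proof.
move=> mb mf b0 f0 r0 H.
pose g (k : nat) x := (Num.min (f x) k%:R `^ r * b x)%:E.
have m0 (k : nat) x : 0 <= Num.min (f x) k%:R by rewrite le_min f0 ler0n.
have mg k : measurable_fun setT (g k).
  apply/measurable_EFinP/measurable_funM => //.
  apply: (measurableT_comp (measurable_powR _)); exact: measurable_minr.
have g0 k x : setT x -> (0 <= g k x)%E.
  by move=> _; rewrite lee_fin mulr_ge0 ?powR_ge0.
have ndg x : setT x -> {homo g ^~ x : n m / (n <= m)%N >-> (n <= m)%E}.
  move=> _ m n mn; rewrite lee_fin ler_wpM2r// ge0_ler_powR ?nnegrE//.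
  by rewrite le_min ge_min lexx/= ge_min ler_nat mn orbT.
have := @cvg_monotone_convergence _ _ _ P _ measurableT _ mg g0 ndg.
have -> : (\int[P]_x limn (g ^~ x) = \int[P]_x (f x `^ r * b x)%:E)%E.
  apply: eq_integral => x _; apply/cvg_lim => //.
  have [k _ fk] : exists2 k, True & f x <= k%:R.
    by exists (Num.bound (f x)) => //; rewrite ltW// archi_boundP.
  apply: cvg_near_cst.
  near=> n; rewrite /g; congr ((_ `^ _ * _)%:E); apply/min_idPl.
  by apply: (le_trans fk); rewrite ler_nat; near: n; exists k.
move=> /cvg_lim <- //; apply: lime_le.
  by apply/cvg_ex; eexists; exact: (@cvg_monotone_convergence _ _ _ P _ measurableT _ mg g0 ndg).
by near=> n; exact: H.
Unshelve. all: by end_near. Qed.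

End integrals.

(** * Conditional expectation: multipliers, comparison and good versions *)

Section conditional_expectation.
Context {R : realType} {d : measure_display} {T : measurableType d}.
Variables (P : probability T R) (G : set (set T)).
Hypotheses (sG : sigma_algebra setT G) (Gm : G `<=` measurable).
Local Notation I f := (\int[P]_x (f x)%:E)%E.
Implicit Types f g : T -> R.

Import HBNNSimple.

(** Reduces a [G]-simple multiplier to integrals over its level sets; these lie in [G], where a
    function and its conditional expectation have equal integrals. *)
Lemma integral_nnsfun_mul (s : {nnsfun g_sigma_algebraType G >-> R}) f :
  P.-integrable setT (EFin \o f) ->
  (\int[P]_x (s x * f x)%:E =
   \sum_(y \in range s) y%:E * \int[P]_(x in s @^-1` [set y]) (f x)%:E)%E.
Proof.
move=> If.
have ms y : measurable (s @^-1` [set y] : set T).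
  by apply: Gm; rewrite -gmeasE//; exact: measurable_sfunP.
have Ify y : P.-integrable setT ((EFin \o f) \_ (s @^-1` [set y])).
  by apply/integrable_restrict => //; rewrite setTI; exact: integrableS If.
rewrite fsbig_finite//=.
transitivity (\int[P]_x (\sum_(y <- finmap.enum_fset (fset_set (range s)))
    y%:E * ((EFin \o f) \_ (s @^-1` [set y])) x))%E.
  apply: eq_integral => x _.
  rewrite fimfunE fsbig_finite//= mulr_suml -sumEFin; apply: eq_bigr => y _.
  rewrite patchE indicE; case: ifPn => _; first by rewrite mulr1 EFinM.
  by rewrite mulr0 mul0r mule0.
rewrite integral_sum//; last by move=> y; exact: integrableZl.
by apply: eq_bigr => y _; rewrite integralZl// [in RHS]integral_mkcond.
Qed.

(** Holds for simple multipliers and extends to nonnegative bounded ones by dominated convergence; a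
    signed [a] is written as [(a + C) - C]. *)
Lemma cond_exp_integral_bounded f g (a : T -> R) (C : R) :
  P.-integrable setT (EFin \o f) -> is_cond_exp P G f g ->
  gmeas G a -> (forall x, `|a x| <= C) ->
  (\int[P]_x (a x * g x)%:E = \int[P]_x (a x * f x)%:E)%E.
Proof.
move=> If [mg Ig gf] ma aC.
have nneg (b : T -> R) : gmeas G b -> (forall x, 0 <= b x <= C + C) ->
    (\int[P]_x (b x * g x)%:E = \int[P]_x (b x * f x)%:E)%E.
  move=> mb b0.
  have mEb : @measurable_fun _ _ (g_sigma_algebraType G) _ setT (EFin \o b).
    exact/measurable_EFinP.
  pose s n := nnsfun_approx measurableT mEb n.
  have cvgs u : P.-integrable setT (EFin \o u) ->
      (\int[P]_x (s n x * u x)%:E @[n --> \oo] --> \int[P]_x (b x * u x)%:E)%E.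
    move=> Iu; have mu : measurable_fun setT u.
      exact/measurable_EFinP/(measurable_int P).
    have ms n : measurable_fun [set: T] (s n : T -> R).
      by apply: (gmeas_measurable sG Gm) => //; exact: measurable_funPT.
    have s0 n x : 0 <= s n x by [].
    have sb n x : s n x <= b x.
      rewrite -lee_fin /s nnsfun_approxE; apply: le_approx => // y _.
      by rewrite lee_fin; case/andP: (b0 y).
    have [|||||_ _] := @dominated_convergence _ _ _ P setT measurableT
      (fun n x => (s n x * u x)%:E) (fun x => (b x * u x)%:E)
      (fun x => (C + C)%:E * `|(u x)%:E|)%E.
    - by move=> n; exact/measurable_EFinP/measurable_funM.
    - by apply/measurable_EFinP/measurable_funM => //; exact: gmeas_measurable mb.
    - apply: aeW => x _; apply: cvg_EFin; first by near=> n.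
      apply: cvgMl; have : (EFin \o (s ^~ x)) n @[n --> \oo] --> (b x)%:E.
        apply: cvg_nnsfun_approx => // y _.
        by rewrite lee_fin; case/andP: (b0 y).
      by move=> /fine_cvg.
    - by apply: integrableZl => //; exact: integrable_abse.
    - apply: aeW => x n _; rewrite abse_EFin -EFinM lee_fin normrM ler_wpM2r//.
      by rewrite ger0_norm// (le_trans (sb _ _))//; case/andP: (b0 x).
    by [].
  rewrite -(cvg_lim _ (cvgs _ Ig))// -(cvg_lim _ (cvgs _ If))//.
  congr (limn _); apply/funext => n; rewrite !integral_nnsfun_mul//.
  apply: eq_fsbigr => y _; rewrite gf// -gmeasE//; exact: measurable_sfunP.
have C0 (x : T) : 0 <= C by rewrite (le_trans _ (aC x)).
have bC u : P.-integrable setT (EFin \o u) ->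
    (\int[P]_x (a x * u x)%:E = \int[P]_x ((a x + C) * u x)%:E - \int[P]_x (C * u x)%:E)%E.
  move=> Iu; rewrite -integralB_EFin//.
  - by apply: eq_integral => x _; rewrite -EFinB; congr EFin; ring.
  - apply: (integrable_bounded_mul (C := C + C)) => //.
      by apply: measurable_funD => //; exact: gmeas_measurable ma.
    move=> x; rewrite (le_trans (ler_normD _ _))// lerD// ger0_norm//; exact: C0 x.
  - apply: (integrable_bounded_mul (C := C)) => // x.
    by rewrite ger0_norm//; exact: C0 x.
rewrite !bC//; congr (_ - _)%E.
  apply: nneg => [|x]; first exact: measurable_funD.
  have := aC x; rewrite ler_norml => /andP[? ?].
  by rewrite lerD2r -lerBlDr sub0r; apply/andP.
by apply: nneg => // x; rewrite (C0 x) lerDl (C0 x).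
Unshelve. all: by end_near. Qed.

(** Here [a] may be unbounded and both sides infinite: monotone convergence along the truncations
    [Num.min (a x) k%:R] gives each of the two inequalities. *)
Lemma cond_exp_integral f g (a : T -> R) :
  P.-integrable setT (EFin \o f) -> is_cond_exp P G f g ->
  (forall x, 0 <= f x) -> (forall x, 0 <= g x) ->
  gmeas G a -> (forall x, 0 <= a x) ->
  (\int[P]_x (a x * g x)%:E = \int[P]_x (a x * f x)%:E)%E.
Proof.
move=> If fg f0 g0 ma a0; have [mg Ig _] := fg.
have ma' := gmeas_measurable sG Gm ma.
have mf : measurable_fun setT f by exact/measurable_EFinP/(measurable_int P).
have {}mg : measurable_fun setT g by exact/measurable_EFinP/(measurable_int P).
have mink (k : nat) : (\int[P]_x (Num.min (a x) k%:R * g x)%:E =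
    \int[P]_x (Num.min (a x) k%:R * f x)%:E)%E.
  apply: (cond_exp_integral_bounded (C := k%:R)) => //.
    exact: measurable_minr.
  by move=> x; rewrite ger0_norm ?le_min ?a0 ?ler0n// ge_min lexx orbT.
have aux (u u' : T -> R) : measurable_fun setT u -> (forall x, 0 <= u x) ->
    measurable_fun setT u' -> (forall x, 0 <= u' x) ->
    (forall k : nat, \int[P]_x (Num.min (a x) k%:R * u x)%:E =
     \int[P]_x (Num.min (a x) k%:R * u' x)%:E)%E ->
    (\int[P]_x (a x * u x)%:E <= \int[P]_x (a x * u' x)%:E)%E.
  move=> mu u0 mu' u'0 uu'.
  rewrite (eq_integral (fun x => (a x `^ 1 * u x)%:E)); last first.
    by move=> x _; rewrite powRr1.
  apply: integral_min_le => // k.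
  rewrite (eq_integral (fun x => (Num.min (a x) k%:R * u x)%:E)); last first.
    by move=> x _; rewrite powRr1// le_min a0 ler0n.
  rewrite uu'; apply: ge0_integral_le => //.
  - by apply: measurable_funM => //; exact: measurable_minr.
  - exact: measurable_funM.
  - by move=> x; rewrite mulr_ge0// le_min a0 ler0n.
  - by move=> x; rewrite mulr_ge0.
  - by apply: aeW => x; rewrite ler_wpM2r// ge_min lexx.
by apply/eqP; rewrite eq_le !aux.
Qed.

(** Integrate over [A = {g' < g}], a set of [G]: the integral of [g - g'] over [A] is at most [0]
    although the integrand is positive there, so [A] is null. *)
Lemma le_cond_exp f f' g g' :
  P.-integrable setT (EFin \o f) -> is_cond_exp P G f g ->
  P.-integrable setT (EFin \o f') -> is_cond_exp P G f' g' ->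
  (forall x, f x <= f' x) -> \forall x \ae P, g x <= g' x.
Proof.
move=> If [/(measurable_wrtP _ sG) mg Ig fg] If' [/(measurable_wrtP _ sG) mg' Ig' fg'] ff'.
pose A := [set x | g' x < g x].
have GA : G A.
  by apply: (gmeas_bool sG); exact: measurable_fun_ltr.
have mA := Gm GA.
have m1 : measurable_fun setT (fun x => g x - g' x).
  by apply: measurable_funB; exact: (gmeas_measurable sG Gm).
have int0 : (\int[P]_(x in A) `|(g x - g' x)%:E| = 0)%E.
  apply/eqP; rewrite eq_le; apply/andP; split; last exact: integral_ge0.
  have -> : (\int[P]_(x in A) `|(g x - g' x)%:E| =
      \int[P]_(x in A) ((g x)%:E - (g' x)%:E))%E.
    apply: eq_integral => x /set_mem /ltW Ax.
    by rewrite gee0_abs ?lee_fin ?subr_ge0.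
  have sub u : P.-integrable setT (EFin \o u) -> P.-integrable A (EFin \o u).
    by move=> Iu; exact: integrableS Iu.
  rewrite integralB_EFin ?fg ?fg'//; try exact: sub.
  rewrite sube_le0; apply: le_integral => //; try exact: sub.
  by move=> x _; rewrite lee_fin.
have [/(_ int0)[N [mN PN AN]] _] := ae_eq_integral_abs P mA
  (measurable_funTS (iffRL (measurable_EFinP _ _) m1)).
exists N; split => // x /= /negP; rewrite -ltNge => gg'.
apply: AN => /= H; have [e] := H gg'.
by move: gg'; rewrite -subr_gt0 e ltxx.
Qed.

(** Over [{g <= 0}], a set of [G], the integral of [f] equals that of [g] and is at most [0]; as
    [f > 0], this set is null. *)
Lemma cond_exp_gt0 f g : P.-integrable setT (EFin \o f) -> is_cond_exp P G f g ->
  (forall x, 0 < f x) -> \forall x \ae P, 0 < g x.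
Proof.
move=> If [/(measurable_wrtP _ sG) mg Ig fg] f0.
pose A := [set x | g x <= 0].
have GA : G A.
  by apply: (gmeas_bool sG); apply: measurable_fun_ler => //; exact: measurable_cst.
have mA := Gm GA.
have mf : measurable_fun setT (EFin \o f) by exact: (measurable_int P).
have int0 : (\int[P]_(x in A) `|(f x)%:E| = 0)%E.
  apply/eqP; rewrite eq_le; apply/andP; split; last exact: integral_ge0.
  under eq_integral do rewrite gee0_abs ?lee_fin ?ltW//.
  rewrite -fg// -(integral0 P A); apply: le_integral => //.
  - exact: integrableS Ig.
  - exact: integrable0.
  - by move=> x /set_mem Ax; rewrite lee_fin.
have [/(_ int0)[N [mN PN AN]] _] := ae_eq_integral_abs P mA (measurable_funTS mf).
exists N; split => // x /= /negP; rewrite -leNgt => gx.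
apply: AN => /= H; have [e] := H gx.
by have := f0 x; rewrite e ltxx.
Qed.

Lemma is_cond_exp_ae_eq f g g' : is_cond_exp P G f g -> gmeas G g' ->
  (\forall x \ae P, g x = g' x) -> is_cond_exp P G f g'.
Proof.
move=> [/(measurable_wrtP _ sG) mg Ig fg] mg' gg'.
have mgT := gmeas_measurable sG Gm mg.
have mgT' := gmeas_measurable sG Gm mg'.
have E A : measurable A -> (\int[P]_(x in A) (g x)%:E = \int[P]_(x in A) (g' x)%:E)%E.
  move=> mA; apply: ae_eq_integral => //; try exact/measurable_funTS/measurable_EFinP.
  by apply: filterS gg' => x -> _.
split; first exact/measurable_wrtP.
- apply/integrableP; split; first exact/measurable_EFinP.
  case/integrableP: Ig => _; apply: le_lt_trans.
  apply: ae_ge0_le_integral => //; try by apply: measurableT_comp => //; exact/measurable_EFinP.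
  by apply: filterS gg' => x /= -> _.
- by move=> A GA; rewrite -E ?fg//; exact: Gm.
Qed.

Lemma is_cond_exp_cst (c : R) : is_cond_exp P G (cst c) (cst c).
Proof.
split => //; last exact: finite_measure_integrable_cst.
by apply/measurable_wrtP => //; exact: measurable_cst.
Qed.

(** Provides a version obeying the bound at every point, so that pathwise arguments and divisions
    meet no exceptional set. *)
Lemma cond_exp_ge_version f c : P.-integrable setT (EFin \o f) ->
  (forall x, c <= f x) ->
  exists g, [/\ gmeas G g, is_cond_exp P G f g, (forall x, c <= g x) &
                \forall x \ae P, g x = cond_exp P G f x].
Proof.
move=> If cf; have fE := cond_expP sG Gm If.
have mE : gmeas G (cond_exp P G f) by case: fE => /(measurable_wrtP _ sG).
have Ic : P.-integrable setT (EFin \o cst c) by exact: finite_measure_integrable_cst.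
have ge := le_cond_exp Ic (is_cond_exp_cst c) If fE cf.
have mm : gmeas G (fun x => Num.max c (cond_exp P G f x)).
  by apply: measurable_maxr => //; exact: measurable_cst.
exists (fun x => Num.max c (cond_exp P G f x)); split => //.
- apply: is_cond_exp_ae_eq fE mm _.
  by apply: filterS ge => x /= cx; apply/esym/max_idPr.
- by move=> x; rewrite le_max lexx.
- by apply: filterS ge => x /= cx; apply/max_idPr.
Qed.

Lemma cond_exp_gt0_version f : P.-integrable setT (EFin \o f) ->
  (forall x, 0 < f x) ->
  exists g, [/\ gmeas G g, is_cond_exp P G f g, (forall x, 0 < g x) &
                \forall x \ae P, g x = cond_exp P G f x].
Proof.
move=> If f0; have fE := cond_expP sG Gm If.
have mE : gmeas G (cond_exp P G f) by case: fE => /(measurable_wrtP _ sG).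
have gt := cond_exp_gt0 If fE f0.
(* The value [1] alters the chosen version on a null set only. *)
pose g x := if 0 < cond_exp P G f x then cond_exp P G f x else 1.
have mm : gmeas G g.
  apply: measurable_fun_ifT => //.
  exact: measurable_fun_ltr.
exists g; split => //.
- by apply: is_cond_exp_ae_eq fE mm _; apply: filterS gt => x /= cx; rewrite /g cx.
- by move=> x; rewrite /g; case: ifP.
- by apply: filterS gt => x /= cx; rewrite /g cx.
Qed.

End conditional_expectation.

(** * Real powers and the pathwise form of Doob's inequality *)

Lemma powR_pred {R : realType} (q z : R) : 1 < q -> 0 <= z ->
  z `^ q = z `^ (q - 1) * z.
Proof.
move=> q1 z0; have q0 : q != 0 by rewrite gt_eqF//; lra.
have := @powRD _ z (q - 1) 1; rewrite subrK (negbTE q0) powRr1//.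
exact.
Qed.

Lemma measurable_funpowR {R : realType} d (T : measurableType d) (f : T -> R) (r : R) :
  measurable_fun setT f -> measurable_fun setT (fun x => f x `^ r).
Proof. by move=> mf; exact: (measurableT_comp (measurable_powR r) mf). Qed.

Section pathwise_doob.
Context {R : realType}.
Variables (q : R) (X : nat -> R) (m : R).
Hypotheses (q1 : 1 < q) (X0 : forall i, 0 <= X i) (m0 : 0 <= m).

Fixpoint runmax n : R := if n is i.+1 then Num.max (runmax i) (X i.+1) else X 0%N.

Lemma runmax_ge0 n : 0 <= runmax n.
Proof. by elim: n => //= n IH; rewrite le_max IH. Qed.

Lemma le_runmax i n : (i <= n)%N -> X i <= runmax n.
Proof.
elim: n => [|n IH]; first by rewrite leqn0 => /eqP ->.
rewrite leq_eqVlt => /predU1P[->|]; first by rewrite /= le_max lexx orbT.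
by move=> /IH Xi; rewrite /= le_max Xi.
Qed.

(** Truncation at [m] keeps the [q]-th moment finite, which lets Doob's argument absorb it. *)
Definition truncmax n : R := Num.min (runmax n) m.

Definition truncmax_incr n : R :=
  truncmax n `^ (q - 1) - (if n is i.+1 then truncmax i `^ (q - 1) else 0).

Lemma truncmax_ge0 n : 0 <= truncmax n.
Proof. by rewrite le_min runmax_ge0. Qed.

Lemma truncmax_incr_ge0 n : 0 <= truncmax_incr n.
Proof.
rewrite /truncmax_incr subr_ge0; case: n => [|n]; first exact: powR_ge0.
rewrite ge0_ler_powR ?nnegrE ?truncmax_ge0 ?subr_ge0 ?(ltW q1)//.
by rewrite /truncmax le_min !ge_min/= le_max !lexx orbT.
Qed.

Lemma sum_truncmax_incr n : \sum_(i < n.+1) truncmax_incr i = truncmax n `^ (q - 1).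
Proof.
elim: n => [|n IH]; first by rewrite big_ord_recl big_ord0 addr0 /truncmax_incr subr0.
by rewrite big_ord_recr/= IH /truncmax_incr subrKC.
Qed.

(** Young's inequality for [a ^ (q - 1) * b] with the exponents [q / (q - 1)] and [q]. *)
Lemma powR_sub_le (a b : R) : 0 <= a -> 0 <= b ->
  b `^ q - a `^ q <= q / (q - 1) * ((b `^ (q - 1) - a `^ (q - 1)) * b).
Proof.
move=> a0 b0; have q0 : 0 < q by move: q1; lra.
have qq1 : 0 < q - 1 by move: q1; lra.
have := @conjugate_powR _ b (a `^ (q - 1)) q (q / (q - 1)) b0 (powR_ge0 _ _) q0.
rewrite divr_gt0// -powRrM mulrCA divff ?gt_eqF// mulr1 => /(_ isT).
rewrite invf_div => /(_ _)/wrap[].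
  by rewrite -[X in X + _]mul1r -mulrDl subrKC divff// gt_eqF.
rewrite (powR_pred q1 b0) => H.
have -> : b `^ (q - 1) * b - a `^ q = q / (q - 1) *
    ((q - 1) / q * (b `^ (q - 1) * b - a `^ q)).
  by rewrite mulrA mulf_div (mulrC q) divff ?mul1r// mulf_neq0// gt_eqF.
rewrite ler_wpM2l ?divr_ge0 ?(ltW q0) ?(ltW qq1)//.
have e1 : (q - 1) / q = 1 - q^-1 by rewrite mulrBl divff ?gt_eqF// mul1r.
by move: H; rewrite e1; lra.
Qed.

(** Telescoping [powR_sub_le] gives the sum with [truncmax] in place of [X]. An increment is nonzero
    only when [X] sets a new maximum, and then [truncmax] is at most [X]. *)
Lemma doob_path n :
  truncmax n `^ q <= q / (q - 1) * \sum_(i < n.+1) truncmax_incr i * X i.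
Proof.
have qq1 : 0 < q - 1 by move: q1; lra.
have cq0 : 0 <= q / (q - 1) by rewrite divr_ge0//; move: q1; lra.
elim: n => [|n IH].
  rewrite big_ord_recl big_ord0 addr0.
  have := powR_sub_le (lexx 0) (truncmax_ge0 0).
  rewrite !powR0 ?gt_eqF//; last by move: q1; lra.
  rewrite !subr0 => /le_trans; apply; rewrite ler_wpM2l// /truncmax_incr subr0.
  by rewrite ler_wpM2l ?powR_ge0// /truncmax ge_min lexx.
rewrite big_ord_recr/= mulrDr -lerBlDl (le_trans _ (_ : truncmax n.+1 `^ q - truncmax n `^ q <= _))//.
  by rewrite lerB.
apply: (le_trans (powR_sub_le (truncmax_ge0 n) (truncmax_ge0 n.+1))).
rewrite ler_wpM2l// -/(truncmax_incr n.+1).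
have [Xn|Xn] := leP (X n.+1) (runmax n).
  by rewrite /truncmax_incr /truncmax /= (max_idPl Xn) subrr !mul0r.
rewrite ler_wpM2l ?truncmax_incr_ge0// /truncmax /= (max_idPr (ltW Xn)).
by rewrite ge_min lexx.
Qed.

(** If [b <= e * a] the first term suffices, otherwise the second. A small [e] makes the first term
    absorbable. *)
Lemma young_split (e a b : R) : 0 < e -> 0 <= a -> 0 <= b ->
  a `^ (q - 1) * b <= e * a `^ q + e^-1 `^ (q - 1) * b `^ q.
Proof.
move=> e0 a0 b0; have q0 : 0 < q by move: q1; lra.
have [bea|eab] := leP b (e * a).
  apply: (@le_trans _ _ (e * a `^ q)).
    by rewrite (powR_pred q1 a0) mulrCA ler_wpM2l ?powR_ge0.
  by rewrite lerDl mulr_ge0 ?powR_ge0.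
apply: (@le_trans _ _ (e^-1 `^ (q - 1) * b `^ q)); last first.
  by rewrite lerDr mulr_ge0 ?powR_ge0// ltW.
rewrite (powR_pred q1 b0) mulrA ler_wpM2r// -powRM ?invr_ge0 ?(ltW e0)//.
rewrite ge0_ler_powR ?nnegrE ?mulr_ge0 ?invr_ge0 ?(ltW e0)//; first by move: q1; lra.
by rewrite mulrC ler_pdivlMr// mulrC ltW.
Qed.

End pathwise_doob.

(** * Doob's maximal inequality under a change of measure *)

Section doob.
Context {R : realType} {d : measure_display} {T : measurableType d}.
Variables (P : probability T R) (F : nat -> set (set T)).
Hypotheses (sF : forall n, sigma_algebra setT (F n)) (Fm : forall n, F n `<=` measurable)
  (Fle : forall m n, (m <= n)%N -> F m `<=` F n).

Lemma gmeas_le (m n : nat) d' (U : measurableType d') (f : T -> U) : (m <= n)%N ->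
  gmeas (F m) f -> gmeas (F n) f.
Proof. by move=> mn; apply: gmeas_sub => //; exact: Fle. Qed.

Lemma gmeas_meas n d' (U : measurableType d') (f : T -> U) :
  gmeas (F n) f -> measurable_fun setT f.
Proof. by apply: gmeas_measurable => //; exact: Fm. Qed.

(** [XP] expresses, through nonnegative adapted multipliers, that [X i] is at most the conditional
    expectation of [g] given [F i] for the measure [u dP]. *)
Variables (q : R) (u g : T -> R) (X : nat -> T -> R).
Hypotheses (q1 : 1 < q) (u0 : forall x, 0 <= u x)
  (Iu : P.-integrable setT (EFin \o u)) (g0 : forall x, 0 <= g x)
  (mg : measurable_fun setT g)
  (X0 : forall i x, 0 <= X i x) (mX : forall i, gmeas (F i) (X i))
  (XP : forall i (a : T -> R), gmeas (F i) a -> (forall x, 0 <= a x) ->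
    (\int[P]_x (a x * X i x * u x)%:E <= \int[P]_x (a x * g x * u x)%:E)%E).

Lemma gmeas_runmax n : gmeas (F n) (fun x => runmax (X ^~ x) n).
Proof.
elim: n => [|n IH] /=; first exact: mX.
by apply: measurable_maxr; [exact: gmeas_le IH|exact: mX].
Qed.

Lemma gmeas_truncmax (m : R) n : gmeas (F n) (fun x => truncmax (X ^~ x) m n).
Proof. by apply: measurable_minr => //; exact: gmeas_runmax. Qed.

Lemma gmeas_truncmax_incr (m : R) n : gmeas (F n) (fun x => truncmax_incr q (X ^~ x) m n).
Proof.
have mp k : gmeas (F k) (fun x => truncmax (X ^~ x) m k `^ (q - 1)).
  by apply: measurable_funpowR; exact: gmeas_truncmax.
apply: measurable_funB => //; case: n => [//|n].
by apply: (gmeas_le (leqnSn n)); exact: mp.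
Qed.

(** Integrate [doob_path] against [u]: the increments are adapted, so [XP] replaces every [X i] by
    [g] and the sum collapses to the terminal power. Absorbing half of the left side doubles the
    classical constant [q / (q - 1)]. *)
Theorem doob n : (\int[P]_x (runmax (X ^~ x) n `^ q * u x)%:E <=
  ((2 * (q / (q - 1))) `^ q)%:E * \int[P]_x (g x `^ q * u x)%:E)%E.
Proof.
have mu : measurable_fun setT u by exact/measurable_EFinP/(measurable_int P).
have qq1 : 0 < q - 1 by move: q1; lra.
have [c cE c0] : exists2 c, c = q / (q - 1) & 0 < c.
  by exists (q / (q - 1)) => //; rewrite divr_gt0//; move: q1; lra.
rewrite -cE.
have mgq : measurable_fun setT (fun x => g x `^ q * u x).
  apply: measurable_funM => //; exact: measurable_funpowR.
have gq0 x : 0 <= g x `^ q * u x by rewrite mulr_ge0 ?powR_ge0.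
apply: integral_min_le => //.
- by apply: gmeas_meas; exact: gmeas_runmax.
- by move=> x; exact: runmax_ge0.
- by move: q1; lra.
move=> m; rewrite -/(truncmax (X ^~ _) m%:R n).
pose M x := truncmax (X ^~ x) m%:R n.
have M0 x : 0 <= M x by apply: truncmax_ge0.
have mM : measurable_fun setT M by apply: gmeas_meas; exact: gmeas_truncmax.
have mMp r : measurable_fun setT (fun x => M x `^ r).
  exact: measurable_funpowR.
have mMq : measurable_fun setT (fun x => M x `^ q * u x) by exact: measurable_funM.
pose D i x := truncmax_incr q (X ^~ x) m%:R i.
have D0 i x : 0 <= D i x by apply: truncmax_incr_ge0.
have mD i : measurable_fun setT (D i) by apply: gmeas_meas; exact: gmeas_truncmax_incr.
have mXT i : measurable_fun setT (X i) by apply: gmeas_meas; exact: mX.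
(* Finite since [M] is at most [m] and [u] is integrable; this permits the subtraction at the
   end. *)
have fin : (\int[P]_x (M x `^ q * u x)%:E \is a fin_num)%E.
  apply: integrable_fin_num => //.
  apply: (integrable_bounded_mul (C := m%:R `^ q)) => // x.
  rewrite ger0_norm ?powR_ge0// ge0_ler_powR ?nnegrE ?ler0n//; first by move: q1; lra.
  by rewrite /M /truncmax ge_min lexx orbT.
have step1 : (\int[P]_x (M x `^ q * u x)%:E <=
    c%:E * \int[P]_x (M x `^ (q - 1) * g x * u x)%:E)%E.
  apply: (@le_trans _ _ (\int[P]_x (c * (\sum_(i < n.+1) D i x * X i x * u x))%:E)%E).
    apply: ge0_integral_le => //.
    - apply: measurable_funM => //; apply: measurable_sum => i.
      by apply: measurable_funM => //; exact: measurable_funM.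
    - by move=> x; rewrite mulr_ge0 ?powR_ge0.
    - by move=> x; rewrite mulr_ge0 ?(ltW c0)// sumr_ge0// => i _; rewrite !mulr_ge0.
    - apply: aeW => x; rewrite -mulr_suml mulrA ler_wpM2r//.
      by rewrite cE; exact: doob_path.
  rewrite ge0_integral_mulr ?(ltW c0)//; last 2 first.
  - apply: measurable_sum => i.
    by apply: measurable_funM => //; exact: measurable_funM.
  - by move=> x; rewrite sumr_ge0// => i _; rewrite !mulr_ge0.
  rewrite lee_pmul2l// ge0_integral_sumr//; last 2 first.
  - by move=> i; apply: measurable_funM => //; exact: measurable_funM.
  - by move=> i x; rewrite !mulr_ge0.
  apply: (@le_trans _ _ (\sum_(i < n.+1) \int[P]_x (D i x * g x * u x)%:E)%E).
    by apply: lee_sum => i _; apply: XP => //; exact: gmeas_truncmax_incr.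
  rewrite -ge0_integral_sumr//; last 2 first.
  - by move=> i; apply: measurable_funM => //; exact: measurable_funM.
  - by move=> i x; rewrite !mulr_ge0.
  rewrite le_eqVlt; apply/orP; left; apply/eqP; apply: eq_integral => x _.
  by rewrite -!mulr_suml sum_truncmax_incr.
have step2 : (c%:E * \int[P]_x (M x `^ (q - 1) * g x * u x)%:E <=
    2^-1%:E * \int[P]_x (M x `^ q * u x)%:E +
    (2^-1 * (2 * c) `^ q)%:E * \int[P]_x (g x `^ q * u x)%:E)%E.
  rewrite -!ge0_integral_mulr ?(ltW c0) ?mulr_ge0 ?powR_ge0//; try by
    [move=> x; rewrite !mulr_ge0 ?powR_ge0
    |apply: measurable_funM => //; exact: measurable_funM].
  rewrite -ge0_integral_add//; try by
    [move=> x; rewrite !mulr_ge0 ?powR_ge0|exact: measurable_funM].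
  apply: ge0_integral_le => //.
  - by apply: measurable_funM => //; apply: measurable_funM => //; exact: measurable_funM.
  - by apply: measurable_funD; exact: measurable_funM.
  - by move=> x; rewrite !mulr_ge0 ?powR_ge0 ?(ltW c0).
  - by move=> x; rewrite addr_ge0 ?mulr_ge0 ?powR_ge0.
  apply: aeW => x; rewrite !mulrA -mulrDl ler_wpM2r//.
  (* With [e = 1 / (2 * c)], the factor [c] leaves exactly one half of the integral of [M ^ q]. *)
  have := @young_split _ q q1 (2 * c)^-1 (M x) (g x).
  rewrite invr_gt0 mulr_gt0// => /(_ isT (M0 x) (g0 x)).
  move=> /(ler_wpM2l (ltW c0)); rewrite mulrDr !mulrA => /le_trans; apply.
  rewrite invrK invfM (mulrC 2^-1) mulrA divff ?gt_eqF// mul1r lerD2l.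
  rewrite ler_wpM2r ?powR_ge0// (powR_pred q1) ?mulr_ge0 ?(ltW c0)//.
  by rewrite le_eqVlt; apply/orP; left; apply/eqP; field.
move: (le_trans step1 step2) => {step1 step2}.
rewrite -(fineK fin); set A := fine _.
have : (0 <= \int[P]_x (g x `^ q * u x)%:E)%E.
  by apply: integral_ge0 => x _; rewrite lee_fin.
case: (\int[P]_x (g x `^ q * u x)%:E)%E => [B| |] //=.
- by rewrite !lee_fin => B0; rewrite -mulrA; set Z := (2 * c) `^ q * B; lra.
- by move=> _ _; rewrite gt0_muley ?leey// lte_fin powR_gt0// mulr_gt0.
Qed.

End doob.

(** * The conditional weak type (1,1) inequality *)

Section weak_type.
Context {R : realType} {d : measure_display} {T : measurableType d}.
Variables (P : probability T R) (F : nat -> set (set T)).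
Hypotheses (sF : forall n, sigma_algebra setT (F n)) (Fm : forall n, F n `<=` measurable)
  (Fle : forall m n, (m <= n)%N -> F m `<=` F n).

Local Notation gle := (gmeas_le sF Fle).
Local Notation gT := (gmeas_meas sF Fm).

Lemma gmeas_sgr n (f : T -> R) : gmeas (F n) f -> gmeas (F n) (fun x => Num.sg (f x)).
Proof.
move=> mf.
have -> : (fun x => Num.sg (f x)) =
    (fun x => if f x < 0 then - 1 else if 0 < f x then 1 else 0).
  by apply/funext => x; case: ltgtP => // [/ltr0_sg|/gtr0_sg|->//]; rewrite ?sgr0.
apply: measurable_fun_ifT => //; first exact: measurable_fun_ltr.
by apply: measurable_fun_ifT => //; exact: measurable_fun_ltr.
Qed.

Lemma gmeas_normr n (f : T -> R) : gmeas (F n) f -> gmeas (F n) (fun x => `|f x|).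
Proof. by move=> mf; exact: (measurableT_comp (@normr_measurable R setT) mf). Qed.

Lemma gmeas_inv n (f : T -> R) : (forall x, 0 < f x) ->
  gmeas (F n) f -> gmeas (F n) (fun x => (f x)^-1).
Proof.
move=> f0 mf; have -> : (fun x => (f x)^-1) = (fun x => f x `^ (- 1)).
  by apply/funext => x; rewrite -powR_inv1// ltW.
exact: measurable_funpowR.
Qed.

Variables (l : T -> R) (n : nat) (e : R) (X v : nat -> T -> R) (f : T -> R).
Hypotheses (e0 : 0 < e) (el : forall x, e <= l x) (ml : gmeas (F n) l)
  (If : P.-integrable setT (EFin \o f))
  (mX : forall i, gmeas (F i) (X i)) (Xf : forall i, is_cond_exp P (F i) f (X i))
  (mv : forall i, gmeas (F i) (v i)) (v1 : forall i x, `|v i x| <= 1).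

Let l0 x : 0 < l x. Proof. exact: lt_le_trans (el x). Qed.

Let Y k x := stopped_transform (l x) (fun j => X (n + j) x) (fun j => v (n + j) x) k.

Let coef k x := burk_coef (l x) (fun j => X (n + j) x) (fun j => v (n + j) x) k.

Let IX i : P.-integrable setT (EFin \o X i). Proof. by have [] := Xf i. Qed.

Lemma gmeas_stopped k : gmeas (F (n + k)) (Y k).
Proof.
rewrite /Y; elim: k => [//|k IH] /=.
have IH' : gmeas (F (n + k.+1)) (Y k) by apply: (gle _ IH); rewrite addnS.
have le : (n + k <= n + k.+1)%N by rewrite addnS.
have mv' : gmeas (F (n + k.+1)) (v (n + k)%N) := gle le (@mv (n + k)%N).
have mX' : gmeas (F (n + k.+1)) (X (n + k)%N) := gle le (@mX (n + k)%N).
have ml' : gmeas (F (n + k.+1)) l := gle (leq_addr _ _) ml.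
apply: measurable_fun_ifT => //.
  by apply: measurable_fun_ler => //; exact: gmeas_normr.
apply: measurable_funD => //; apply: measurable_funM => //.
by apply: measurable_funB => //; exact: mX.
Qed.

Lemma gmeas_burk_coef k : gmeas (F (n + k)) (coef k).
Proof.
have mY := @gmeas_stopped k; have mXk := @mX (n + k)%N.
have ml' : gmeas (F (n + k)) l by apply: (gle _ ml); exact: leq_addr.
have mil : gmeas (F (n + k)) (fun x => (l x)^-1) by exact: gmeas_inv.
have mr : gmeas (F (n + k)) (fun x => `|X (n + k) x| + `|Y k x| <= l x).
  by apply: measurable_fun_ler => //; apply: measurable_funD; exact: gmeas_normr.
rewrite /coef /burk_coef /burk_dx /burk_dy; apply: measurable_funD.
  apply: measurable_fun_ifT => //.
    apply: measurable_funM => //; apply: measurable_funN.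
    exact: measurable_funM.
  by apply: measurable_funN; apply: measurable_funM => //; exact: gmeas_sgr.
apply: measurable_funM.
  apply: measurable_fun_ifT => //; apply: measurable_funM => //.
  exact: measurable_funM.
rewrite /stopped_mult; apply: measurable_fun_ifT => //.
by apply: measurable_fun_ler => //; exact: gmeas_normr.
Qed.

(** Testing against [F n]-measurable [a] makes the estimate conditional on [F n], with a random
    level [l] and paths restarted at time [n]. It is [stopped_transform_gt] times [a / l],
    integrated. *)
Lemma weak_type k (a : T -> R) (C : R) : gmeas (F n) a -> (forall x, 0 <= a x <= C) ->
  (\int[P]_x (if l x < `|Y k x| then a x else 0)%:E <=
   \int[P]_x (2 * (a x / l x) * `|X (n + k) x|)%:E)%E.
Proof.
move=> ma aC.
have a0 x : 0 <= a x by case/andP: (aC x).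
have mil : gmeas (F n) (fun x => (l x)^-1) by exact: gmeas_inv.
have mal : gmeas (F n) (fun x => a x / l x) by exact: measurable_funM.
have al0 x : 0 <= a x / l x by rewrite divr_ge0 ?(ltW (l0 x)).
(* The lower bound [e] of [l] makes [a / l] bounded, so that the products below are integrable. *)
have alC x : a x / l x <= C / e.
  rewrite ler_pdivrMr// (le_trans (_ : _ <= C))//; first by case/andP: (aC x).
  rewrite -mulrA ler_peMr//; first by case/andP: (aC x) => /le_trans; apply.
  by rewrite mulrC ler_pdivlMr// mul1r.
pose D i x := X (n + i).+1 x - X (n + i) x.
have mc i : gmeas (F (n + i)) (fun x => a x / l x * coef i x).
  apply: measurable_funM; last exact: gmeas_burk_coef.
  by apply: (gle _ mal); exact: leq_addr.
have cC i x : `|a x / l x * coef i x| <= C / e * 4.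
  by rewrite normrM ler_pM// ?burk_coef_le// (ger0_norm (al0 x)).
have Iprod i j : P.-integrable setT (EFin \o (fun x => a x / l x * coef i x * X j x)).
  apply: (integrable_bounded_mul (C := C / e * 4)) => //.
  exact: gT (mc i).
have mart i : (\int[P]_x (a x / l x * coef i x * D i x)%:E = 0)%E.
  under eq_integral do rewrite mulrBr EFinB.
  rewrite integralB_EFin//.
  (* The coefficient is measurable at time [n + i], so against [X j] for any later [j] it integrates
     as against [f]; the increment therefore contributes zero. *)
  have tower j : (n + i <= j)%N -> (\int[P]_x (a x / l x * coef i x * X j x)%:E =
      \int[P]_x (a x / l x * coef i x * f x)%:E)%E.
    move=> ij; apply: (cond_exp_integral_bounded (sF j) (@Fm j) If (Xf j) _ (cC i)).
    exact: (gle _ (mc i)).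
  rewrite !tower ?leqnSn// subee//; apply: integrable_fin_num => //.
  apply: (integrable_bounded_mul (C := C / e * 4)) => //.
  exact: gT (mc i).
have I2 : P.-integrable setT (EFin \o (fun x => 2 * (a x / l x) * `|X (n + k) x|)).
  apply: (integrable_bounded_mul (C := 2 * (C / e))).
  - by apply: measurable_funM => //; exact: gT mal.
  - by move=> x; rewrite normrM (ger0_norm (al0 x)) ger0_norm// ler_wpM2l.
  - exact: integrable_norm.
have ID i : P.-integrable setT (EFin \o (fun x => a x / l x * coef i x * D i x)).
  have := integrableB measurableT (Iprod i (n + i).+1) (Iprod i (n + i)).
  by apply: eq_integrable => // x _ /=; rewrite -EFinB -mulrBr.
have Isum : P.-integrable setT
    (fun x => \sum_(i < k) (a x / l x * coef i x * D i x)%:E)%E.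
  by apply: integrable_sum => // i _; exact: ID.
apply: (@le_trans _ _ (\int[P]_x ((2 * (a x / l x) * `|X (n + k) x|)%:E +
    \sum_(i < k) (a x / l x * coef i x * D i x)%:E))%E).
  apply: le_integral => //.
  - apply: (bounded_fun_integrable P (C := C)).
      apply: measurable_fun_ifT => //; last exact: gT ma.
      apply: measurable_fun_ltr; first exact: gT ml.
      by apply: (gT (n := n + k)); apply: gmeas_normr; exact: gmeas_stopped.
    move=> x; have /andP[_ aCx] := aC x.
    by case: ifP => _; rewrite ?normr0 ?(ger0_norm (a0 x))// (le_trans (a0 x)).
  - exact: integrableD.
  move=> x _; rewrite sumEFin -EFinD lee_fin.
  have := @stopped_transform_gt _ (l x) (fun j => X (n + j) x)
    (fun j => v (n + j) x) (l0 x) (fun i => v1 (n + i) x) k.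
  move=> /(ler_wpM2l (al0 x)); rewrite -/(Y k x) mulrDr mulr_sumr => H.
  rewrite (le_trans (le_trans _ H))//.
    case: ifP => _; last by rewrite mulr0.
    by rewrite -mulrA mulVf ?mulr1// gt_eqF.
  rewrite le_eqVlt; apply/orP; left; apply/eqP; congr (_ + _); first by ring.
  by apply: eq_bigr => i _; rewrite -mulrA addnS.
rewrite integralD//.
rewrite (_ : \int[P]_x (\sum_(i < k) _)%E = 0)%E ?adde0//.
rewrite (integral_sum measurableT); last by move=> i; exact: ID.
by apply: big1 => i _; exact: mart.
Qed.

End weak_type.

(** * Stopping events and their conditional probabilities *)

Section sparse.
Context {R : realType} {d : measure_display} {T : measurableType d}.
Variables (P : probability T R) (F : nat -> set (set T)).
Hypotheses (sF : forall n, sigma_algebra setT (F n)) (Fm : forall n, F n `<=` measurable)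
  (Fle : forall m n, (m <= n)%N -> F m `<=` F n).

Local Notation gle := (gmeas_le sF Fle).
Local Notation gT := (gmeas_meas sF Fm).

Variables (e : R) (X v H : nat -> T -> R) (f h : T -> R).
Hypotheses (e0 : 0 < e)
  (If : P.-integrable setT (EFin \o f))
  (mX : forall i, gmeas (F i) (X i)) (Xf : forall i, is_cond_exp P (F i) f (X i))
  (mv : forall i, gmeas (F i) (v i)) (v1 : forall i x, `|v i x| <= 1)
  (Ih : P.-integrable setT (EFin \o h))
  (mH : forall i, gmeas (F i) (H i)) (Hh : forall i, is_cond_exp P (F i) h (H i))
  (eH : forall i x, e <= H i x)
  (XH : forall i, \forall x \ae P, `|X i x| <= H i x).

Definition mtransform n x : R := \sum_(i < n) v i x * (X i.+1 x - X i x).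

(** The threshold [8] turns the weak type constant [2] into [1 / 4]; the two causes of a stop then
    add up to [1 / 2]. *)
Definition stop n x : bool := stops 8 (mtransform ^~ x) (H ^~ x) n.

Definition stop_in n k x : bool := stops_in 8 (mtransform ^~ x) (H ^~ x) n k.

Let H0 i x : 0 < H i x. Proof. exact: lt_le_trans (eH i x). Qed.

Lemma gmeas_mtransform n : gmeas (F n) (mtransform n).
Proof.
elim: n => [|n IH].
  have -> : mtransform 0 = cst 0 by apply/funext => x; exact: big_ord0.
  exact: measurable_cst.
have -> : mtransform n.+1 = (fun x => mtransform n x + v n x * (X n.+1 x - X n x)).
  by apply/funext => x; rewrite /mtransform big_ord_recr.
have mv' : gmeas (F n.+1) (v n) := gle (leqnSn n) (@mv n).
have mX' : gmeas (F n.+1) (X n) := gle (leqnSn n) (@mX n).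
have IH' := gle (leqnSn n) IH.
apply: measurable_funD => //; apply: measurable_funM => //.
by apply: measurable_funB => //; exact: mX.
Qed.

Lemma gmeas_stop_state n :
  gmeas (F n) (fun x => (stop_state 8 (mtransform ^~ x) (H ^~ x) n).1) /\
  gmeas (F n) (fun x => (stop_state 8 (mtransform ^~ x) (H ^~ x) n).2) /\
  gmeas (F n) (stop n).
Proof.
elim: n => [|n [IH1 [IH2 _]]].
  split; first exact: mH.
  by split; [exact: gmeas_mtransform|exact: measurable_cst].
have {}IH1 := gle (leqnSn n) IH1; have {}IH2 := gle (leqnSn n) IH2.
have mt := @gmeas_mtransform n.+1; have mHn := @mH n.+1.
have ms : gmeas (F n.+1) (stop n.+1).
  rewrite /stop /stops; apply: measurable_or; apply: measurable_fun_ltr.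
  - exact: measurable_funM.
  - by apply: gmeas_normr; exact: measurable_funB.
  - exact: measurable_funM.
  - by apply: gmeas_normr; exact: measurable_funB.
split; [|split] => //.
- rewrite [X in measurable_fun _ X](_ : _ = (fun x => if stop n.+1 x then H n.+1 x else
    (stop_state 8 (mtransform ^~ x) (H ^~ x) n).1)); first exact: measurable_fun_ifT.
  by apply/funext => x; rewrite stop_stateS /stop; case: ifP.
- rewrite [X in measurable_fun _ X](_ : _ = (fun x => if stop n.+1 x then mtransform n.+1 x else
    (stop_state 8 (mtransform ^~ x) (H ^~ x) n).2)); first exact: measurable_fun_ifT.
  by apply/funext => x; rewrite stop_stateS /stop; case: ifP.
Qed.

Lemma gmeas_stop n : gmeas (F n) (stop n).
Proof. by have [_ []] := gmeas_stop_state n. Qed.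

Lemma measurable_stop_in n k : measurable_fun setT (stop_in n k).
Proof.
elim: k => [|k IH]; first exact: measurable_cst.
have -> : stop_in n k.+1 = (fun x => stop_in n k x || stop (n + k.+1) x) by [].
apply: measurable_or => //.
exact: gT (@gmeas_stop _).
Qed.

Lemma mtransformB n j x : mtransform (n + j) x - mtransform n x =
  \sum_(i < j) v (n + i) x * (X (n + i).+1 x - X (n + i) x).
Proof. by rewrite /mtransform big_split_ord/= addrAC subrr add0r. Qed.

(** Presents [H] as its own transform with multiplier [1], so that [weak_type] covers both causes of
    a stop. *)
Lemma sum_diff_martingale n j x : H (n + j) x - H n x =
  \sum_(i < j) 1 * (H (n + i.+1) x - H (n + i) x).
Proof.
elim: j => [|j IH]; first by rewrite big_ord0 addn0 subrr.
by rewrite big_ord_recr/= -IH mul1r addrC addrA subrK.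
Qed.

(** A further stop within [k] steps needs an excursion of the transform or of [H] beyond [8 * H n].
    Each has conditional probability at most [1 / 4], by [weak_type], [|X| <= H] and the martingale
    property of [H]. *)
Lemma stop_tail n k (a : T -> R) (C : R) : gmeas (F n) a ->
  (forall x, 0 <= a x <= C) ->
  (\int[P]_x (if stop n x && stop_in n k x then a x else 0)%:E <=
   2^-1%:E * \int[P]_x (if stop n x then a x else 0)%:E)%E.
Proof.
move=> ma aC; have a0 x : 0 <= a x by case/andP: (aC x).
pose b x := if stop n x then a x else 0.
have mb : gmeas (F n) b.
  by apply: measurable_fun_ifT => //; exact: gmeas_stop.
have b0 x : 0 <= b x by rewrite /b; case: ifP.
have bC x : 0 <= b x <= C.
  by rewrite /b; case: ifP => // _; rewrite lexx; case/andP: (aC x) => /le_trans; apply.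
pose l x := 8 * H n x.
have ml : gmeas (F n) l by apply: measurable_funM => //; exact: mH.
have el x : e <= l x by have := eH n x; have := H0 n x; rewrite /l; lra.
have l0 x : 0 < l x by rewrite mulr_gt0.
have mil : gmeas (F n) (fun x => (l x)^-1) by exact: gmeas_inv.
have mbl : gmeas (F n) (fun x => 2 * (b x / l x)).
  by apply: measurable_funM => //; exact: measurable_funM.
have bl0 x : 0 <= 2 * (b x / l x) by rewrite mulr_ge0// divr_ge0// ltW.
have h0 x : 0 <= H n x by exact: ltW.
pose Y1 x := stopped_transform (l x) (fun j => X (n + j) x) (fun j => v (n + j) x) k.
pose Y2 x := stopped_transform (l x) (fun j => H (n + j) x) (fun j => 1) k.
have mY1 : measurable_fun setT (fun x => l x < `|Y1 x|).
  apply: measurable_fun_ltr; first exact: gT ml.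
  by apply: (gT (n := n + k)); apply: gmeas_normr; exact: gmeas_stopped.
have mY2 : measurable_fun setT (fun x => l x < `|Y2 x|).
  apply: measurable_fun_ltr; first exact: gT ml.
  apply: (gT (n := n + k)); apply: gmeas_normr.
  exact: (@gmeas_stopped _ _ _ F sF Fle l n H (fun _ _ => 1)).
have mbT := gT mb; have mHT i : measurable_fun setT (H i) := gT (@mH i).
have mblT := gT mbl.
(* Against [F n]-measurable multipliers [H (n + k)] and [H n] both integrate as [h] does, and
   [2 / l = 1 / (4 * H n)]. *)
have bound : (\int[P]_x (2 * (b x / l x) * H (n + k) x)%:E =
    4^-1%:E * \int[P]_x (b x)%:E)%E.
  have tower j : (n <= j)%N -> (\int[P]_x (2 * (b x / l x) * H j x)%:E =
      \int[P]_x (2 * (b x / l x) * h x)%:E)%E.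
    move=> nj; apply: (cond_exp_integral_bounded (C := 2 * (C / e)) (sF j) (@Fm j) Ih (Hh j)).
      exact: (gle nj mbl).
    move=> x; rewrite ger0_norm// ler_wpM2l// ler_pM ?invr_ge0 ?(ltW (l0 x))//.
      by case/andP: (bC x).
    by rewrite lef_pV2 ?posrE.
  rewrite tower ?leq_addr// -(tower n)// -ge0_integral_mulr//.
  apply: eq_integral => x _; congr EFin; rewrite /l.
  by field; rewrite gt_eqF.
have half : (2^-1%:E = 4^-1%:E + 4^-1%:E :> \bar R)%E.
  by rewrite -EFinD; congr EFin; lra.
have Ib0 : (0 <= \int[P]_x (b x)%:E)%E.
  by apply: integral_ge0 => x _; rewrite lee_fin.
rewrite half ge0_muleDl// -bound.
apply: (@le_trans _ _ (\int[P]_x (if l x < `|Y1 x| then b x else 0)%:E +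
    \int[P]_x (if l x < `|Y2 x| then b x else 0)%:E)%E).
  rewrite -ge0_integral_add//; try by
    [move=> x; case: ifP|apply: measurable_fun_ifT].
  apply: ge0_integral_le.
  - apply: measurable_fun_ifT => //; last exact: gT ma.
    by apply: measurable_and; [exact: gT (@gmeas_stop n)|exact: measurable_stop_in].
  - by apply: measurable_funD; exact: measurable_fun_ifT.
  - by move=> x; case: ifP.
  - by move=> x; apply: addr_ge0; case: ifP.
  apply: aeW => x; case: ifPn => [/andP[sn sk]|_]; last by apply: addr_ge0; case: ifP.
  have bE : b x = a x by rewrite /b sn.
  have [j jk] := stops_inP sn sk; rewrite mtransformB sum_diff_martingale => -[] lj.
  - have -> : l x < `|Y1 x|.
      by apply: (stopped_transform_max jk); under eq_bigr do rewrite addnS.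
    by rewrite bE lerDl; case: ifP.
  - have -> : l x < `|Y2 x| by apply: (stopped_transform_max jk).
    by rewrite bE lerDr; case: ifP.
apply: leeD.
- apply: (le_trans (weak_type sF Fm Fle e0 el ml If mX Xf mv v1 k mb bC)).
  apply: ge0_integral_le => //.
  + apply: measurable_funM => //; apply: (gT (n := n + k)); apply: gmeas_normr; exact: mX.
  + exact: measurable_funM.
  + by move=> x; rewrite mulr_ge0.
  + by move=> x; rewrite mulr_ge0// ltW.
  + by apply: filterS (XH (n + k)) => x XHx; rewrite ler_wpM2l.
- have v1' (i : nat) (x : T) : `|(1 : R)| <= 1 by rewrite normr1.
  apply: (le_trans (weak_type sF Fm Fle e0 el ml Ih mH Hh (v := fun _ _ => 1) _ v1' k mb bC)).
    by move=> i; exact: measurable_cst.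
  apply: ge0_integral_le => //.
  + apply: measurable_funM => //; apply: (gT (n := n + k)); apply: gmeas_normr; exact: mH.
  + exact: measurable_funM.
  + by move=> x; rewrite mulr_ge0.
  + by move=> x; rewrite mulr_ge0// ltW.
  + by apply: aeW => x; rewrite ger0_norm// ltW.
Qed.

Variables (rho : T -> R) (r : nat -> T -> R).
Hypotheses (Irho : P.-integrable setT (EFin \o rho)) (rho0 : forall x, 0 < rho x)
  (mr : forall i, gmeas (F i) (r i)) (rrho : forall i, is_cond_exp P (F i) rho (r i))
  (r0 : forall i x, 0 < r i x).

Definition core n k x : bool :=
  [&& stop n x, ~~ stop_in n k x & rho x <= 4 * r n x].

Lemma measurable_core n k : measurable_fun setT (core n k).
Proof.
apply: measurable_and; first exact: gT (@gmeas_stop n).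
apply: measurable_and; first by apply: measurable_neg; exact: measurable_stop_in.
apply: measurable_fun_ler; first exact/measurable_EFinP/(measurable_int P).
by apply: measurable_funM => //; exact: gT (@mr n).
Qed.

(** Conditionally on [F n], a later stop removes at most one half of the stopping event, and
    [rho > 4 * r n] at most one quarter by Markov's inequality; one quarter remains. *)
Lemma stop_core n k (a : T -> R) : gmeas (F n) a -> (forall x, 0 <= a x) ->
  (\int[P]_x (if stop n x then a x else 0)%:E <=
   4%:E * \int[P]_x (if core n k x then a x else 0)%:E)%E.
Proof.
move=> ma a0.
have mst := @gmeas_stop n; have mstT := gT mst.
have msti := measurable_stop_in n k.
have mcore := measurable_core n k.
have mrho : measurable_fun setT rho by exact/measurable_EFinP/(measurable_int P).
have mrn := gT (@mr n).
have mrho4 : measurable_fun setT (fun x => 4 * r n x < rho x).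
  by apply: measurable_fun_ltr => //; exact: measurable_funM.
(* Bounded multipliers come first: for them the integral over the stopping event is finite and can
   be subtracted. *)
have bounded (b : T -> R) (C : R) : gmeas (F n) b -> (forall x, 0 <= b x <= C) ->
    (\int[P]_x (if stop n x then b x else 0)%:E <=
     4%:E * \int[P]_x (if core n k x then b x else 0)%:E)%E.
  move=> mb bC; have b0 x : 0 <= b x by case/andP: (bC x).
  have mbT := gT mb.
  pose s x := if stop n x then b x else 0.
  have ms : gmeas (F n) s by exact: measurable_fun_ifT.
  have s0 x : 0 <= s x by rewrite /s; case: ifP.
  have msT := gT ms.
  have tail := @stop_tail n k b C mb bC.
  have markov : (\int[P]_x (if stop n x && (4 * r n x < rho x) then b x else 0)%:E <=
      4^-1%:E * \int[P]_x (s x)%:E)%E.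
    have mir : gmeas (F n) (fun x => (4 * r n x)^-1).
      apply: gmeas_inv; first by move=> x; rewrite mulr_gt0.
      by apply: measurable_funM => //; exact: mr.
    have msr : gmeas (F n) (fun x => s x / (4 * r n x)) by exact: measurable_funM.
    have sr0 x : 0 <= s x / (4 * r n x) by rewrite divr_ge0// mulr_ge0// ltW.
    have := cond_exp_integral (sF n) (@Fm n) Irho (rrho n) (fun x => ltW (rho0 x))
      (fun x => ltW (r0 n x)) msr sr0.
    rewrite -ge0_integral_mulr//.
    rewrite (eq_integral (fun x => (4^-1 * s x)%:E)) => [->|x _]; last first.
      by congr EFin; field; rewrite gt_eqF.
    apply: ge0_integral_le.
    - by apply: measurable_fun_ifT => //; exact: measurable_and.
    - by apply: measurable_funM => //; exact: gT msr.
    - by move=> x; case: ifP.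
    - by move=> x; rewrite mulr_ge0// ltW.
    apply: aeW => x; case: ifPn => [/andP[sn rx]|_]; last by rewrite mulr_ge0// ltW.
    rewrite /s sn -mulrA ler_peMr// mulrC ler_pdivlMr ?mulr_gt0// mul1r ltW//.
  have fin : (\int[P]_x (s x)%:E \is a fin_num)%E.
    apply: integrable_fin_num => //; apply: (bounded_fun_integrable P (C := C)) => // x.
    have /andP[_ bCx] := bC x.
    by rewrite (ger0_norm (s0 x)) /s; case: ifP => // _; exact: (le_trans (b0 x)).
  have split : (\int[P]_x (s x)%:E <= \int[P]_x (if core n k x then b x else 0)%:E +
      (2^-1%:E * \int[P]_x (s x)%:E + 4^-1%:E * \int[P]_x (s x)%:E))%E.
    apply: (@le_trans _ _ (\int[P]_x (if core n k x then b x else 0)%:E +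
      (\int[P]_x (if stop n x && stop_in n k x then b x else 0)%:E +
       \int[P]_x (if stop n x && (4 * r n x < rho x) then b x else 0)%:E))%E); last first.
      by rewrite leeD2l// leeD.
    rewrite -!ge0_integral_add//; try by
      [move=> x; case: ifP|move=> x; apply: addr_ge0; case: ifP
      |apply: measurable_fun_ifT => //; exact: measurable_and
      |apply: measurable_fun_ifT
      |apply: measurable_funD; apply: measurable_fun_ifT => //; exact: measurable_and].
    apply: ge0_integral_le => //.
    - apply: measurable_funD; first exact: measurable_fun_ifT.
      by apply: measurable_funD; apply: measurable_fun_ifT => //; exact: measurable_and.
    - by move=> x; do ?apply: addr_ge0; case: ifP.
    apply: aeW => x; rewrite /s /core; have := b0 x.
    case: (stop n x) => /=; last by move=> _; rewrite !addr0.
    by case: (stop_in n k x) => /=; case: (leP (rho x)) => /= _; lra.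
  move: split; rewrite -/(s _).
  have : (0 <= \int[P]_x (if core n k x then b x else 0)%:E)%E.
    by apply: integral_ge0 => x _; rewrite lee_fin; case: ifP.
  rewrite -(fineK fin); set A := fine _.
  case: (\int[P]_x (if core n k x then b x else 0)%:E)%E => [B| |] //=.
  - by rewrite !lee_fin; lra.
  - by move=> _ _; rewrite gt0_muley ?leey.
(* A first power times an indicator is the form in which [integral_min_le] removes the
   boundedness. *)
have aE x : (if stop n x then a x else 0) = a x `^ 1 * (if stop n x then 1 else 0).
  by rewrite powRr1//; case: ifP; rewrite ?mulr1 ?mulr0.
under eq_integral do rewrite aE.
apply: integral_min_le => //.
- exact: measurable_fun_ifT.
- exact: gT ma.
- by move=> x; case: ifP.
move=> m; have m0 x : 0 <= Num.min (a x) m%:R by rewrite le_min a0 ler0n.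
rewrite (eq_integral (fun x => (if stop n x then Num.min (a x) m%:R else 0)%:E)); last first.
  by move=> x _; rewrite powRr1//; case: ifP; rewrite ?mulr1 ?mulr0.
apply: (le_trans (bounded (fun x => Num.min (a x) m%:R) m%:R _ _)).
- exact: measurable_minr.
- by move=> x; rewrite m0 ge_min lexx orbT.
rewrite lee_pmul2l//; apply: ge0_integral_le.
- by apply: measurable_fun_ifT => //; apply: measurable_minr => //; exact: gT ma.
- by apply: measurable_fun_ifT => //; exact: gT ma.
- by move=> x; case: ifP.
- by move=> x; case: ifP.
- by apply: aeW => x; case: ifP => // _; rewrite ge_min lexx.
Qed.

End sparse.

(** * The weighted bound for the sparse sum *)

Section sparse_bound.
Context {R : realType} {d : measure_display} {T : measurableType d}.
Variables (P : probability T R) (F : nat -> set (set T)).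
Hypotheses (sF : forall n, sigma_algebra setT (F n)) (Fm : forall n, F n `<=` measurable)
  (Fle : forall m n, (m <= n)%N -> F m `<=` F n).

Local Notation gle := (gmeas_le sF Fle).
Local Notation gT := (gmeas_meas sF Fm).

(* [Y / U] is the conditional expectation of [y / u] for the measure [u dP]. *)
Lemma weighted_cond_exp n (u U y Y a : T -> R) :
  P.-integrable setT (EFin \o u) -> (forall x, 0 < u x) ->
  gmeas (F n) U -> is_cond_exp P (F n) u U -> (forall x, 0 < U x) ->
  P.-integrable setT (EFin \o y) -> (forall x, 0 <= y x) ->
  gmeas (F n) Y -> is_cond_exp P (F n) y Y -> (forall x, 0 <= Y x) ->
  gmeas (F n) a -> (forall x, 0 <= a x) ->
  (\int[P]_x (a x * (Y x / U x) * u x)%:E = \int[P]_x (a x * y x)%:E)%E.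
Proof.
move=> Iu u0 mU uU U0 Iy y0 mY yY Y0 ma a0.
have mYU : gmeas (F n) (fun x => a x * (Y x / U x)).
  by apply: measurable_funM => //; apply: measurable_funM => //; exact: gmeas_inv.
rewrite -(cond_exp_integral (sF n) (@Fm n) Iu uU (fun x => ltW (u0 x))
  (fun x => ltW (U0 x)) mYU); last first.
  by move=> x; rewrite mulr_ge0// divr_ge0// ltW.
rewrite -(cond_exp_integral (sF n) (@Fm n) Iy yY)//.
by apply: eq_integral => x _; rewrite mulrA mulfVK// gt_eqF.
Qed.

Variables (e : R) (X v H : nat -> T -> R) (f h : T -> R).
Hypotheses (e0 : 0 < e)
  (If : P.-integrable setT (EFin \o f))
  (mX : forall i, gmeas (F i) (X i)) (Xf : forall i, is_cond_exp P (F i) f (X i))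
  (mv : forall i, gmeas (F i) (v i)) (v1 : forall i x, `|v i x| <= 1)
  (Ih : P.-integrable setT (EFin \o h)) (h0 : forall x, 0 <= h x)
  (mH : forall i, gmeas (F i) (H i)) (Hh : forall i, is_cond_exp P (F i) h (H i))
  (eH : forall i x, e <= H i x)
  (XH : forall i, \forall x \ae P, `|X i x| <= H i x).

Variables (w sigma rho : T -> R) (W S r : nat -> T -> R).
Hypotheses
  (Iw : P.-integrable setT (EFin \o w)) (w0 : forall x, 0 < w x)
  (mW : forall i, gmeas (F i) (W i)) (wW : forall i, is_cond_exp P (F i) w (W i))
  (W0 : forall i x, 0 < W i x)
  (Is : P.-integrable setT (EFin \o sigma)) (s0 : forall x, 0 < sigma x)
  (mS : forall i, gmeas (F i) (S i)) (sS : forall i, is_cond_exp P (F i) sigma (S i))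
  (S0 : forall i x, 0 < S i x)
  (Irho : P.-integrable setT (EFin \o rho)) (rho0 : forall x, 0 < rho x)
  (mr : forall i, gmeas (F i) (r i)) (rrho : forall i, is_cond_exp P (F i) rho (r i))
  (r0 : forall i x, 0 < r i x).

(** These hypotheses treat [p >= 2] and [p < 2] together. [SWK] is the [A_p] condition rewritten
    with a nonpositive power of the average of the single weight [rho]. *)
Variables (p q s K : R).
Hypotheses (p1 : 1 < p) (q1 : 1 < q) (pq : p^-1 + q^-1 = 1) (s_ge0 : 0 <= s) (K0 : 0 < K)
  (rho_s : forall x, rho x `^ (- s) = sigma x `^ p^-1 * w x `^ q^-1)
  (sigma_w : forall x, sigma x `^ (1 - p) = w x)
  (SWK : forall i, \forall x \ae P, S i x * W i x <= K * r i x `^ (- s)).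

Let H0 i x : 0 < H i x. Proof. exact: lt_le_trans (eH i x). Qed.

Local Notation stop := (stop X v H).
Local Notation stop_in := (stop_in X v H).
Local Notation core := (core X v H rho r).

(** The sum is a common bound for the Doob constants at [p] and at [q]. *)
Definition doob_const : R := (2 * (p / (p - 1))) `^ p + (2 * (q / (q - 1))) `^ q.

Let p0 : 0 < p. Proof. by move: p1; lra. Qed.
Let q0 : 0 < q. Proof. by move: q1; lra. Qed.

Lemma doob_const_gt0 : 0 < doob_const.
Proof.
rewrite addr_gt0// powR_gt0// mulr_gt0// divr_gt0//; [move: p1|move: q1]; lra.
Qed.

Definition last_stop i N x : bool := stop i x && ~~ stop_in i (N - i) x.

Lemma measurable_last_stop i N : measurable_fun setT (last_stop i N).
Proof.
apply: measurable_and; first exact: gT (gmeas_stop sF Fle mX mv mH (n := i)).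
by apply: measurable_neg; exact: measurable_stop_in.
Qed.

(** The parameter [t] balances the two terms of Young's inequality and is chosen in [sparse_sum_le].
    The core is relaxed to [last_stop i N], since these events are disjoint in [i]. *)
Lemma stop_term_le (t : R) (g G : T -> R) i N : 0 < t ->
  measurable_fun setT g -> (forall x, 0 <= g x) ->
  P.-integrable setT (EFin \o (fun x => g x * w x)) ->
  gmeas (F i) G -> (forall x, 0 <= G x) ->
  is_cond_exp P (F i) (fun x => g x * w x) G ->
  (\int[P]_x ((if stop i x then H i x else 0) * (g x * w x))%:E <=
   (4 `^ (1 + s) * K)%:E * \int[P]_x (if last_stop i N x then
     t `^ p * ((H i x / S i x) `^ p * sigma x) +
     t^-1 `^ q * ((G x / W i x) `^ q * w x) else 0)%:E)%E.
Proof.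
move=> t0 mg g0 Igw mG G0 gG.
have mst := gmeas_stop sF Fle mX mv mH (n := i); have mstT := gT mst.
have mc := measurable_core sF Fm Fle mX mv mH Irho mr i (N - i).
have mls := measurable_last_stop i N.
have mHS : gmeas (F i) (fun x => H i x / S i x).
  by apply: measurable_funM; [exact: mH|exact: gmeas_inv].
have mGW : gmeas (F i) (fun x => G x / W i x).
  by apply: measurable_funM => //; exact: gmeas_inv.
have HS0 x : 0 < H i x / S i x by rewrite divr_gt0.
have GW0 x : 0 <= G x / W i x by rewrite divr_ge0// ltW.
have mrs : gmeas (F i) (fun x => r i x `^ (- s)) by apply: measurable_funpowR; exact: mr.
pose b x := H i x / S i x * (G x / W i x).
have mb : gmeas (F i) b by exact: measurable_funM.
have b0 x : 0 <= b x by rewrite mulr_ge0// ltW.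
pose a x := b x * r i x `^ (- s).
have ma : gmeas (F i) a by exact: measurable_funM.
have a0 x : 0 <= a x by rewrite mulr_ge0// powR_ge0.
have mw : measurable_fun setT w by exact/measurable_EFinP/(measurable_int P).
have msig : measurable_fun setT sigma by exact/measurable_EFinP/(measurable_int P).
have mrho : measurable_fun setT rho by exact/measurable_EFinP/(measurable_int P).
have mstH : gmeas (F i) (fun x => if stop i x then H i x else 0).
  by apply: measurable_fun_ifT => //; exact: mH.
(* The stopping term is [F i]-measurable, so [g * w] may be replaced by [G]. *)
rewrite -(cond_exp_integral (sF i) (@Fm i) Igw gG)//; last 2 first.
- by move=> x; rewrite mulr_ge0// ltW.
- by move=> x; case: ifP => // _; exact: ltW.
apply: (@le_trans _ _ (K%:E * \int[P]_x (if stop i x then a x else 0)%:E)%E).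
  rewrite -ge0_integral_mulr ?(ltW K0)//; last 2 first.
  - by apply: measurable_fun_ifT => //; exact: gT ma.
  - by move=> x; case: ifP.
  apply: ge0_integral_le.
  - by apply: measurable_funM; [exact: gT mstH|exact: gT mG].
  - apply: measurable_funM => //; apply: measurable_fun_ifT => //; exact: gT ma.
  - by move=> x; case: ifP => _; rewrite ?mul0r// mulr_ge0// ltW.
  - by move=> x; case: ifP => _; rewrite ?mulr0// mulr_ge0// ltW.
  apply: filterS (SWK i) => x SW; case: ifP => _; last by rewrite mul0r mulr0.
  (* This factorization brings in the averages for [sigma dP] and [w dP] and leaves [S * W] to the
     [A_p] bound. *)
  have -> : H i x * G x = b x * (S i x * W i x).
    by rewrite /b; field; rewrite !gt_eqF.
  by rewrite /a [leRHS]mulrCA ler_wpM2l.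
apply: (@le_trans _ _ (K%:E * (4%:E * \int[P]_x (if core i (N - i) x then a x else 0)%:E))%E).
  rewrite lee_pmul2l//; apply: (stop_core sF Fm Fle e0 If mX Xf mv v1 Ih mH Hh eH XH) => //.
have mres : measurable_fun setT (fun x =>
    t `^ p * ((H i x / S i x) `^ p * sigma x) + t^-1 `^ q * ((G x / W i x) `^ q * w x)).
  apply: measurable_funD; apply: measurable_funM => //; apply: measurable_funM => //;
    apply: measurable_funpowR; [exact: gT mHS|exact: gT mGW].
have res0 x : 0 <= t `^ p * ((H i x / S i x) `^ p * sigma x) +
    t^-1 `^ q * ((G x / W i x) `^ q * w x).
  by rewrite addr_ge0// mulr_ge0 ?powR_ge0// mulr_ge0 ?powR_ge0// ltW.
rewrite muleA -EFinM (_ : 4 `^ (1 + s) * K = (K * 4) * 4 `^ s); last first.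
  by rewrite powRD ?powRr1//; [ring|apply/implyP => _; rewrite pnatr_eq0].
rewrite (EFinM (K * 4)) -muleA lee_pmul2l//; last by rewrite lte_fin mulr_gt0.
rewrite -ge0_integral_mulr ?powR_ge0//; last 2 first.
- exact: measurable_fun_ifT.
- by move=> x; case: ifP.
apply: ge0_integral_le.
- by apply: measurable_fun_ifT => //; exact: gT ma.
- by apply: measurable_funM => //; exact: measurable_fun_ifT.
- by move=> x; case: ifP.
- by move=> x; case: ifP => _; rewrite ?mulr0// mulr_ge0// powR_ge0.
apply: aeW => x; case: ifPn => [/and3P[sn nsn rx]|_]; last first.
  by case: ifP => _; rewrite ?mulr0// mulr_ge0// powR_ge0.
rewrite /last_stop sn nsn/= /a.
(* On the core [rho <= 4 * r i]; as the exponent [- s] is nonpositive, passing from [r i] to [rho]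
   costs [4 ^ s]. *)
have rs : r i x `^ (- s) <= 4 `^ s * rho x `^ (- s).
  rewrite !powRN ler_pdivlMr ?powR_gt0// mulrC ler_pdivrMr ?powR_gt0//.
  have ri0 : 0 <= r i x by exact: ltW.
  by rewrite -powRM// ge0_ler_powR// nnegrE ?mulr_ge0// ltW.
apply: (le_trans (ler_wpM2l (b0 x) rs)); rewrite mulrCA ler_wpM2l ?powR_ge0// rho_s.
have tq0 : 0 < t^-1 by rewrite invr_gt0.
have A0 : 0 <= t * (H i x / S i x) * sigma x `^ p^-1.
  by rewrite mulr_ge0 ?powR_ge0// ltW// mulr_gt0.
have B0 : 0 <= t^-1 * (G x / W i x) * w x `^ q^-1.
  by rewrite mulr_ge0 ?powR_ge0// mulr_ge0// ltW.
(* By [rho_s] the power of [rho] splits into factors whose [p]-th and [q]-th powers are the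
   densities [sigma] and [w]; [t] and [1 / t] cancel in the product. *)
have := @conjugate_powR _ (t * (H i x / S i x) * sigma x `^ p^-1)
   (t^-1 * (G x / W i x) * w x `^ q^-1) p q.
move=> /(_ A0 B0 p0 q0 pq).
have -> : t * (H i x / S i x) * sigma x `^ p^-1 * (t^-1 * (G x / W i x) * w x `^ q^-1) =
    b x * (sigma x `^ p^-1 * w x `^ q^-1).
  by rewrite /b; field; rewrite !gt_eqF.
move=> /le_trans; apply.
have pw (a' b' c' t' : R) : 0 <= a' -> 0 <= b' -> 0 <= c' -> 0 < t' ->
    (a' * b' * c' `^ t'^-1) `^ t' = a' `^ t' * (b' `^ t' * c').
  move=> *; rewrite powRM ?mulr_ge0 ?powR_ge0// powRM// -powRrM mulVf ?powRr1 ?mulrA//.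
  by rewrite gt_eqF.
rewrite !pw ?(ltW (s0 x)) ?(ltW (w0 x)) ?(ltW t0) ?(ltW tq0) ?(ltW (HS0 x))//.
apply: lerD; rewrite ler_piMr ?invf_le1 ?(ltW p1) ?(ltW q1)//;
  by rewrite mulr_ge0 ?powR_ge0// mulr_ge0 ?powR_ge0// ltW.
Qed.

Definition sparse_sum N x : R := \sum_(i < N.+1) (if stop i x then H i x else 0).

Lemma sparse_sum_ge0 N x : 0 <= sparse_sum N x.
Proof. by rewrite sumr_ge0// => i _; case: ifP => // _; exact: ltW. Qed.

Lemma measurable_stop_term i : measurable_fun setT (fun x => if stop i x then H i x else 0).
Proof.
apply: measurable_fun_ifT => //; last exact: gT (@mH i).
exact: gT (gmeas_stop sF Fle mX mv mH (n := i)).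
Qed.

Lemma measurable_sparse_sum N : measurable_fun setT (sparse_sum N).
Proof. by apply: measurable_sum => i; exact: measurable_stop_term. Qed.

(** After summing [stop_term_le], disjointness bounds the integrand by one term with [H / S] and
    [G / W] replaced by their running maxima, to which Doob's inequality for [sigma dP] and [w dP]
    applies. *)
Lemma sparse_form_le (t : R) (g : T -> R) N : 0 < t ->
  measurable_fun setT g -> (forall x, 0 <= g x) ->
  P.-integrable setT (EFin \o (fun x => g x * w x)) ->
  (\int[P]_x (sparse_sum N x * (g x * w x))%:E <=
   (4 `^ (1 + s) * K * doob_const)%:E *
     ((t `^ p)%:E * \int[P]_x (h x `^ p * w x)%:E +
      (t^-1 `^ q)%:E * \int[P]_x (g x `^ q * w x)%:E))%E.
Proof.
move=> t0 mg g0 Igw.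
have mw : measurable_fun setT w by exact/measurable_EFinP/(measurable_int P).
have msig : measurable_fun setT sigma by exact/measurable_EFinP/(measurable_int P).
have mh : measurable_fun setT h by exact/measurable_EFinP/(measurable_int P).
have gw0 x : 0 <= g x * w x by rewrite mulr_ge0// ltW.
have exG (i : nat) : exists G : T -> R, [/\ gmeas (F i) G,
    is_cond_exp P (F i) (fun x => g x * w x) G, (forall x, 0 <= G x) &
    \forall x \ae P, G x = cond_exp P (F i) (fun x => g x * w x) x].
  exact: (cond_exp_ge_version (sF i) (@Fm i)).
have [G GP] := choice exG.
have mG i : gmeas (F i) (G i) by have [] := GP i.
have gG i : is_cond_exp P (F i) (fun x => g x * w x) (G i) by have [] := GP i.
have G0 i x : 0 <= G i x by have [_ _ /(_ x)] := GP i.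
pose A i x := H i x / S i x; pose B i x := G i x / W i x.
have mA i : gmeas (F i) (A i).
  by apply: measurable_funM; [exact: mH|exact: gmeas_inv].
have mB i : gmeas (F i) (B i).
  by apply: measurable_funM; [exact: mG|exact: gmeas_inv].
have A0 i x : 0 <= A i x by rewrite divr_ge0// ltW.
have B0 i x : 0 <= B i x by rewrite divr_ge0// ltW.
have mrA : measurable_fun setT (fun x => runmax (A ^~ x) N).
  exact: gT (gmeas_runmax sF Fle mA (n := N)).
have mrB : measurable_fun setT (fun x => runmax (B ^~ x) N).
  exact: gT (gmeas_runmax sF Fle mB (n := N)).
have doobA : (\int[P]_x (runmax (A ^~ x) N `^ p * sigma x)%:E <=
    doob_const%:E * \int[P]_x (h x `^ p * w x)%:E)%E.
  have hs0 x : 0 <= h x / sigma x by rewrite divr_ge0// ltW.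
  have mhs : measurable_fun setT (fun x => h x / sigma x).
    apply: measurable_funM => //.
    have -> : (fun x => (sigma x)^-1) = (fun x => sigma x `^ (- 1)).
      by apply/funext => x; rewrite -powR_inv1// ltW.
    exact: measurable_funpowR.
  have := @doob _ _ _ P F sF Fm Fle p sigma (fun x => h x / sigma x) A p1
    (fun x => ltW (s0 x)) Is hs0 mhs A0 mA.
  move=> /(_ _ N)/wrap[].
    move=> i a ma a0; rewrite (weighted_cond_exp Is s0 (@mS i) (sS i) (@S0 i) Ih h0 (@mH i)
      (Hh i) (fun x => ltW (H0 i x)) ma a0).
    rewrite le_eqVlt; apply/orP; left; apply/eqP; apply: eq_integral => x _.
    by congr EFin; rewrite -mulrA divfK// gt_eqF.
  move=> /le_trans; apply.
  (* By [sigma ^ (1 - p) = w], the [sigma]-norm of [h / sigma] is the [w]-norm of [h]. *)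
  have -> : (\int[P]_x ((h x / sigma x) `^ p * sigma x)%:E = \int[P]_x (h x `^ p * w x)%:E)%E.
    apply: eq_integral => x _; congr EFin.
    rewrite powRM ?invr_ge0 ?(ltW (s0 x))// -mulrA; congr (_ * _).
    rewrite -sigma_w powRB; last by apply/implyP => _; rewrite gt_eqF.
    rewrite powRr1 ?(ltW (s0 x))// mulrC; congr (_ * _).
    by rewrite -powR_inv1 ?(ltW (s0 x))// -powRrM mulN1r powRN.
  apply: lee_wpmul2r; last by rewrite lee_fin lerDl powR_ge0.
  by apply: integral_ge0 => x _; rewrite lee_fin mulr_ge0 ?powR_ge0// ltW.
have doobB : (\int[P]_x (runmax (B ^~ x) N `^ q * w x)%:E <=
    doob_const%:E * \int[P]_x (g x `^ q * w x)%:E)%E.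
  have := @doob _ _ _ P F sF Fm Fle q w g B q1
    (fun x => ltW (w0 x)) Iw g0 mg B0 mB.
  move=> /(_ _ N)/wrap[].
    move=> i a ma a0; rewrite (weighted_cond_exp Iw w0 (@mW i) (wW i) (@W0 i) Igw gw0 (@mG i)
      (gG i) (G0 i) ma a0).
    rewrite le_eqVlt; apply/orP; left; apply/eqP; apply: eq_integral => x _.
    by rewrite mulrA.
  move=> /le_trans; apply.
  apply: lee_wpmul2r; last by rewrite lee_fin lerDr powR_ge0.
  by apply: integral_ge0 => x _; rewrite lee_fin mulr_ge0 ?powR_ge0// ltW.
pose Z i x := t `^ p * (A i x `^ p * sigma x) + t^-1 `^ q * (B i x `^ q * w x).
have Z0 i x : 0 <= Z i x.
  by rewrite addr_ge0// mulr_ge0 ?powR_ge0// mulr_ge0 ?powR_ge0// ltW.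
have mZ i : measurable_fun setT (Z i).
  apply: measurable_funD; apply: measurable_funM => //; apply: measurable_funM => //;
    apply: measurable_funpowR; [exact: gT (@mA i)|exact: gT (@mB i)].
have KK : 0 < 4 `^ (1 + s) * K by rewrite mulr_gt0 ?powR_gt0.
apply: (@le_trans _ _ ((4 `^ (1 + s) * K)%:E *
    \int[P]_x (\sum_(i < N.+1) (if last_stop i N x then Z i x else 0))%:E)%E).
  rewrite ge0_integral_sumr//; last 2 first.
  - by move=> i; apply: measurable_fun_ifT => //; exact: measurable_last_stop.
  - by move=> i x; case: ifP.
  rewrite ge0_sume_distrr; last first.
    by move=> i _; apply: integral_ge0 => x _; rewrite lee_fin; case: ifP.
  under eq_integral do rewrite mulr_suml.
  rewrite ge0_integral_sumr; last 2 first.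
  - move=> i; apply: measurable_funM; first exact: measurable_stop_term.
    exact: measurable_funM.
  - by move=> i x; rewrite mulr_ge0//; case: ifP => // _; exact: ltW.
  by apply: lee_sum => i _; exact: stop_term_le.
rewrite (EFinM (_ * K)) -muleA lee_pmul2l//.
have mA' : measurable_fun setT (fun x => runmax (A ^~ x) N `^ p * sigma x).
  by apply: measurable_funM => //; exact: measurable_funpowR.
have mB' : measurable_fun setT (fun x => runmax (B ^~ x) N `^ q * w x).
  by apply: measurable_funM => //; exact: measurable_funpowR.
have rA0 x : 0 <= runmax (A ^~ x) N `^ p * sigma x by rewrite mulr_ge0 ?powR_ge0// ltW.
have rB0 x : 0 <= runmax (B ^~ x) N `^ q * w x by rewrite mulr_ge0 ?powR_ge0// ltW.
apply: (@le_trans _ _ ((t `^ p)%:E * \int[P]_x (runmax (A ^~ x) N `^ p * sigma x)%:E +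
    (t^-1 `^ q)%:E * \int[P]_x (runmax (B ^~ x) N `^ q * w x)%:E)%E).
  rewrite -!ge0_integral_mulr ?powR_ge0//.
  rewrite -ge0_integral_add//; try by
    [exact: measurable_funM|move=> x; rewrite mulr_ge0// powR_ge0].
  apply: ge0_integral_le.
  - apply: measurable_sum => i; apply: measurable_fun_ifT => //.
    exact: measurable_last_stop.
  - by apply: measurable_funD; exact: measurable_funM.
  - by move=> x; rewrite sumr_ge0// => i _; case: ifP.
  - by move=> x; rewrite addr_ge0// mulr_ge0// powR_ge0.
  apply: aeW => x.
  apply: (@sum_last_stop _ 8 (mtransform X v ^~ x) (H ^~ x) (Z ^~ x)) => i iN.
  have Ai : A i x <= runmax (A ^~ x) N by exact: (@le_runmax _ (A ^~ x)).
  have Bi : B i x <= runmax (B ^~ x) N by exact: (@le_runmax _ (B ^~ x)).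
  have pB0 := runmax_ge0 (X := B ^~ x) (fun i => B0 i x) N.
  have pA0 := runmax_ge0 (X := A ^~ x) (fun i => A0 i x) N.
  rewrite /Z; apply: lerD; rewrite ler_wpM2l ?powR_ge0// ler_wpM2r ?(ltW (s0 x)) ?(ltW (w0 x))//;
    by rewrite ge0_ler_powR ?nnegrE// ltW.
rewrite [leRHS]ge0_muleDr; last 2 first.
- rewrite mule_ge0 ?lee_fin ?powR_ge0//; apply: integral_ge0 => x _.
  by rewrite lee_fin mulr_ge0 ?powR_ge0// ltW.
- rewrite mule_ge0 ?lee_fin ?powR_ge0//; apply: integral_ge0 => x _.
  by rewrite lee_fin mulr_ge0 ?powR_ge0// ltW.
by apply: leeD; rewrite muleCA; apply: lee_wpmul2l => //; rewrite lee_fin powR_ge0.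
Qed.

(** Tests the bilinear bound with [g = M ^ (p - 1)], where [M] is the truncated sparse sum:
    [g ^ q = M ^ p], and the tested integral dominates that of [M ^ p * w], finite by the
    truncation. *)
Theorem sparse_sum_le N : (\int[P]_x (sparse_sum N x `^ p * w x)%:E <=
  ((2 * (4 `^ (1 + s) * K * doob_const)) `^ p)%:E *
    \int[P]_x (h x `^ p * w x)%:E)%E.
Proof.
have mw : measurable_fun setT w by exact/measurable_EFinP/(measurable_int P).
have mSS := measurable_sparse_sum N.
have SS0 x := sparse_sum_ge0 N x.
set c := 4 `^ (1 + s) * K * doob_const.
have c0 : 0 < c by rewrite mulr_gt0 ?doob_const_gt0// mulr_gt0 ?powR_gt0.
have c2 : 0 <= 2 * c by exact/ltW/mulr_gt0.
apply: integral_min_le => //.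
- by move=> x; exact: ltW.
- exact: ltW.
move=> m; pose M x := Num.min (sparse_sum N x) m%:R.
have M0 x : 0 <= M x by rewrite le_min SS0 ler0n.
have mM : measurable_fun setT M by exact: measurable_minr.
have mMp z : measurable_fun setT (fun x => M x `^ z) by exact: measurable_funpowR.
have Mm z x : 0 <= z -> `|M x `^ z| <= m%:R `^ z.
  move=> z0; rewrite ger0_norm ?powR_ge0// ge0_ler_powR ?nnegrE ?ler0n//.
  by rewrite /M ge_min lexx orbT.
have qE : q = p / (p - 1).
  have : q^-1 = (p - 1) / p.
    by rewrite mulrBl divff ?gt_eqF// mul1r -pq [RHS]addrAC subrr add0r.
  by move=> /(congr1 GRing.inv); rewrite invrK invf_div.
have p10 : 0 < p - 1 by move: p1; lra.
have pq1 : (p - 1) * q = p by rewrite qE mulrCA divff ?mulr1// gt_eqF.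
(* Then [c * t ^ (- q) = 1 / 2], so half of the integral is absorbed, and
   [2 * c * t ^ p = (2 * c) ^ p]. *)
pose t := (2 * c) `^ q^-1.
have t0 : 0 < t by rewrite powR_gt0// mulr_gt0.
have tp : t `^ p = (2 * c) `^ (p - 1).
  by rewrite /t -powRrM; congr (_ `^ _); rewrite -[X in _ * X]pq1 mulrCA mulVf ?mulr1// gt_eqF.
have tq : t^-1 `^ q = (2 * c)^-1.
  rewrite -powR_inv1 ?(ltW t0)// -powRrM mulN1r powRN /t -powRrM mulVf ?gt_eqF//.
  by rewrite powRr1// mulr_ge0// ltW.
have IMw z : 0 <= z -> P.-integrable setT (EFin \o (fun x => M x `^ z * w x)).
  move=> z0; apply: (integrable_bounded_mul (C := m%:R `^ z)) => // x; exact: Mm.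
have := @sparse_form_le t (fun x => M x `^ (p - 1)) N t0 (mMp _) (fun x => powR_ge0 _ _)
  (IMw _ (ltW p10)).
rewrite -/c tp tq.
have -> : (\int[P]_x ((M x `^ (p - 1)) `^ q * w x)%:E = \int[P]_x (M x `^ p * w x)%:E)%E.
  by apply: eq_integral => x _; rewrite -powRrM pq1.
have fin : (\int[P]_x (M x `^ p * w x)%:E \is a fin_num)%E.
  by apply: integrable_fin_num => //; exact: IMw (ltW p0).
have le1 : (\int[P]_x (M x `^ p * w x)%:E <=
    \int[P]_x (sparse_sum N x * (M x `^ (p - 1) * w x))%:E)%E.
  apply: ge0_integral_le.
  - exact: measurable_funM.
  - by apply: measurable_funM => //; exact: measurable_funM.
  - by move=> x; rewrite mulr_ge0 ?powR_ge0// ltW.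
  - by move=> x; rewrite mulr_ge0// mulr_ge0 ?powR_ge0// ltW.
  apply: aeW => x; rewrite mulrA ler_wpM2r ?(ltW (w0 x))// (powR_pred p1 (M0 x)) mulrC.
  by rewrite ler_wpM2r ?powR_ge0// /M ge_min lexx.
move=> /(le_trans le1); rewrite -/(M _) -(fineK fin); set I := fine _.
have : (0 <= \int[P]_x (h x `^ p * w x)%:E)%E.
  by apply: integral_ge0 => x _; rewrite lee_fin mulr_ge0 ?powR_ge0// ltW.
case: (\int[P]_x (h x `^ p * w x)%:E)%E => [J| |] //=.
- rewrite !lee_fin => J0.
  rewrite (powR_pred p1 c2).
  have -> : c * ((2 * c) `^ (p - 1) * J + (2 * c)^-1 * I) =
     2^-1 * ((2 * c) `^ (p - 1) * (2 * c) * J) + 2^-1 * I.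
    by field; rewrite gt_eqF.
  lra.
- by move=> _ _; rewrite gt0_muley ?leey// lte_fin powR_gt0// mulr_gt0.
Qed.

End sparse_bound.

(** * Comparison of the transform, its partial sums and its maximal function *)

Section transform_bound.
Context {R : realType} {d : measure_display} {T : measurableType d}.
Variables (P : probability T R).

(* The integral of a nonnegative function, measurable or not, is a supremum over
   the simple functions below it. *)
Lemma ge0_le_integralT (f g : T -> \bar R) : (forall x, 0 <= f x)%E ->
  (forall x, f x <= g x)%E -> (\int[P]_x f x <= \int[P]_x g x)%E.
Proof.
move=> f0 fg; have g0 x : (0 <= g x)%E by exact: le_trans (f0 x) (fg x).
rewrite !ge0_integralTE//; apply: le_ereal_sup => _ [k kf <-]; exists k => // x.
exact: le_trans (kf x) (fg x).
Qed.

Lemma is_cond_expN (G : set (set T)) (f g : T -> R) :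
  sigma_algebra setT G -> G `<=` measurable -> P.-integrable setT (EFin \o f) ->
  is_cond_exp P G f g -> is_cond_exp P G (fun x => - f x) (fun x => - g x).
Proof.
move=> sG Gm If [/(measurable_wrtP _ sG) mg Ig fg].
have N u : P.-integrable setT (EFin \o u) -> forall A, measurable A ->
    (\int[P]_(x in A) (- u x)%:E = (- 1)%:E * \int[P]_(x in A) (u x)%:E)%E.
  move=> Iu A mA; rewrite -integralZl//; last exact: integrableS Iu.
  by apply: eq_integral => x _; rewrite -EFinM mulN1r.
split.
- by apply/measurable_wrtP => //; exact: measurable_funN.
- have := integrableN Ig; exact: eq_integrable.
- by move=> A GA; rewrite !N ?fg//; exact: Gm.
Qed.

Lemma abs_cond_exp_le (G : set (set T)) (f g h k : T -> R) :
  sigma_algebra setT G -> G `<=` measurable ->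
  P.-integrable setT (EFin \o f) -> is_cond_exp P G f g ->
  P.-integrable setT (EFin \o h) -> is_cond_exp P G h k ->
  (forall x, `|f x| <= h x) -> \forall x \ae P, `|g x| <= k x.
Proof.
move=> sG Gm If fg Ih hk fh.
have INf : P.-integrable setT (EFin \o (fun x => - f x)).
  have := integrableN If; exact: eq_integrable.
have le1 := le_cond_exp sG Gm If fg Ih hk (fun x => le_trans (ler_norm _) (fh x)).
have le2 := le_cond_exp sG Gm INf (is_cond_expN sG Gm If fg) Ih hk.
have {}le2 : \forall x \ae P, - g x <= k x.
  by apply: le2 => x; rewrite (le_trans (ler_norm _))// normrN.
by apply: filterS2 le1 le2 => x gk Ngk; rewrite ler_norml; lra.
Qed.

Variable F : nat -> set (set T).

Lemma transform_nE (v : nat -> T -> R) (f : T -> R) n x :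
  transform_n P F v f n x = mtransform (fun i => cond_exp P (F i) f) v n x.
Proof. by rewrite /transform_n big_add1/= big_mkord. Qed.

Lemma le_transform_max (v : nat -> T -> R) (f : T -> R) n x :
  (`|transform_n P F v f n x|%:E <= transform_max P F v f x)%E.
Proof. by apply: ereal_sup_ubound; exists n. Qed.

Lemma transform_max_ge0 (v : nat -> T -> R) (f : T -> R) x :
  (0 <= transform_max P F v f x)%E.
Proof. by apply: le_trans (le_transform_max v f 0 x); rewrite lee_fin. Qed.

(* Where the limit does not exist, its default value is [0]. *)
Lemma transform_le_max (v : nat -> T -> R) (f : T -> R) x :
  (`|(transform P F v f x)%:E| <= transform_max P F v f x)%E.
Proof.
rewrite /transform; have [cv|ncv] := pselect (cvgn (fun n => transform_n P F v f n x)).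
  case E : (transform_max P F v f x) => [M| |]; first last.
  - by have := transform_max_ge0 v f x; rewrite E.
  - by rewrite leey.
  rewrite abse_EFin lee_fin -lim_norm//; apply: limr_le; first exact: is_cvg_norm.
  by near=> n; have := le_transform_max v f n x; rewrite E lee_fin.
rewrite dvgP// abse0; exact: transform_max_ge0.
Unshelve. all: by end_near. Qed.

(** Moves the supremum out of the power and the weight, ready for monotone convergence. If the right
    side is a finite [s], every partial sum has modulus at most [(s / b) ^ (1 / p)], hence so does
    the supremum. *)
Lemma transform_max_powR (v : nat -> T -> R) (f : T -> R) (p b : R) x :
  0 < p -> 0 < b ->
  (`|transform_max P F v f x| `^ p * b%:E <=
   ereal_sup (range (fun N =>
     (runmax (fun n => `|transform_n P F v f n x|) N `^ p * b)%:E)))%E.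
Proof.
move=> p0 b0; set L := ereal_sup _.
have ub n : ((`|transform_n P F v f n x| `^ p * b)%:E <= L)%E.
  apply: (@le_trans _ _ (runmax (fun n => `|transform_n P F v f n x|) n `^ p * b)%:E).
    rewrite lee_fin ler_wpM2r ?(ltW b0)// ge0_ler_powR ?nnegrE ?(ltW p0)//.
      exact: runmax_ge0.
    exact: (@le_runmax _ (fun n => `|transform_n P F v f n x|)).
  by apply: ereal_sup_ubound; exists n.
case: L ub => [s ub|ub|ub]; last 2 first.
- by rewrite leey.
- by have := ub 0%N; rewrite leeNy_eq.
have s0 : 0 <= s.
  by have := ub 0%N; rewrite lee_fin; apply: le_trans; rewrite mulr_ge0 ?powR_ge0// ltW.
have sb0 : 0 <= s / b by rewrite divr_ge0// ltW.
have : (transform_max P F v f x <= ((s / b) `^ p^-1)%:E)%E.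
  apply: ge_ereal_sup => _ [n _ <-]; rewrite lee_fin.
  have := ub n; rewrite lee_fin -ler_pdivlMr// => H.
  have -> : `|transform_n P F v f n x| = (`|transform_n P F v f n x| `^ p) `^ p^-1.
    by rewrite -powRrM divff ?powRr1// gt_eqF.
  by rewrite ge0_ler_powR ?nnegrE ?powR_ge0 ?invr_ge0 ?(ltW p0).
rewrite gee0_abs ?transform_max_ge0//; have := transform_max_ge0 v f x.
case: (transform_max P F v f x) => [M| |]//.
rewrite !lee_fin => M0 Ms; rewrite -ler_pdivlMr//.
have -> : s / b = ((s / b) `^ p^-1) `^ p by rewrite -powRrM mulVf ?powRr1// gt_eqF.
by rewrite ge0_ler_powR ?nnegrE ?powR_ge0 ?(ltW p0).
Qed.

End transform_bound.

(** * Exponents and the pointwise [A_p] product *)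

Section exponents.
Context {R : realType}.
Implicit Types p S W A w : R.

Lemma conjugate_exponent p : 1 < p ->
  1 < p / (p - 1) /\ p^-1 + (p / (p - 1))^-1 = 1.
Proof.
move=> p1; have p0 : 0 < p - 1 by lra.
split; first by rewrite ltr_pdivlMr//; lra.
by field; rewrite !gt_eqF//; lra.
Qed.

(** Multiply the hypothesis by [S ^ (2 - p)]. *)
Lemma Ap_product_ge2 p S W A : 0 < S -> W * S `^ (p - 1) <= A ->
  S * W <= A * S `^ (- (p - 2)).
Proof.
move=> S0 WSA; apply: le_trans (ler_wpM2r (powR_ge0 _ _) WSA).
rewrite -mulrA -powRD; last by apply/implyP => _; rewrite gt_eqF.
rewrite (_ : p - 1 - (p - 2) = 1); last by lra.
by rewrite powRr1 ?(ltW S0)// mulrC.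
Qed.

(** Raise the hypothesis to the power [1 / (p - 1)] and multiply by [W ^ (1 - 1 / (p - 1))]. This is
    the source of the exponent [1 / (p - 1)] in the theorem. *)
Lemma Ap_product_lt2 p S W A : 1 < p -> 0 < S -> 0 < W -> W * S `^ (p - 1) <= A ->
  S * W <= A `^ (p - 1)^-1 * W `^ (- (p / (p - 1) - 2)).
Proof.
move=> p1 S0 W0 WSA; have p0 : 0 < p - 1 by lra.
have -> : - (p / (p - 1) - 2) = 1 - (p - 1)^-1 by field; rewrite gt_eqF.
rewrite powRB; last by apply/implyP => _; rewrite gt_eqF.
rewrite powRr1 ?(ltW W0)// mulrCA mulrC ler_wpM2l ?(ltW W0)//.
rewrite ler_pdivlMr ?powR_gt0//.
have -> : S = (S `^ (p - 1)) `^ (p - 1)^-1.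
  by rewrite -powRrM divff ?powRr1 ?(ltW S0)// gt_eqF.
rewrite -powRM ?powR_ge0 ?(ltW W0)// ge0_ler_powR ?nnegrE ?invr_ge0 ?(ltW p0)//.
- by rewrite mulr_ge0 ?powR_ge0// ltW.
- by apply: le_trans WSA; rewrite mulr_ge0 ?powR_ge0// ltW.
- by rewrite mulrC.
Qed.

Lemma dual_powR p w : 1 < p -> 0 < w -> (w `^ (- (p - 1)^-1)) `^ (1 - p) = w.
Proof.
move=> p1 w0; have p0 : 0 < p - 1 by lra.
rewrite -powRrM (_ : - (p - 1)^-1 * (1 - p) = 1); first by rewrite powRr1// ltW.
by field; rewrite gt_eqF.
Qed.

(** The common value equals both [sigma ^ (- (p - 2))] and [w ^ (- (q - 2))], with [q] the conjugate
    exponent; so it is a nonpositive power of [sigma] if [p >= 2] and of [w] if [p < 2]. *)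
Lemma dual_mul_powR p w : 1 < p -> 0 < w ->
  (w `^ (- (p - 1)^-1)) `^ p^-1 * w `^ (p / (p - 1))^-1 = w `^ ((p - 2) / (p - 1)).
Proof.
move=> p1 w0; have p0 : 0 < p - 1 by lra.
rewrite -powRrM -powRD; last by apply/implyP => _; rewrite gt_eqF.
by congr (_ `^ _); field; rewrite !gt_eqF//; lra.
Qed.

(** The exponent [s] of the sparse bound, equal to [max(p, q) - 2] for conjugate [p] and [q]. *)
Definition gap p : R := if 2 <= p then p - 2 else p / (p - 1) - 2.

End exponents.

(** * The maximal function up to a finite time *)

Section finite_horizon.
Context {R : realType} {d : measure_display} {T : measurableType d}.
Variables (P : probability T R) (F : nat -> set (set T)).
Hypotheses (sF : forall n, sigma_algebra setT (F n)) (Fm : forall n, F n `<=` measurable)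
  (Fle : forall m n, (m <= n)%N -> F m `<=` F n).
Variables (p A : R) (w f : T -> R) (v : nat -> T -> R).
Hypotheses (p1 : 1 < p) (A0 : 0 < A)
  (Iw : P.-integrable setT (EFin \o w)) (w0 : forall x, 0 < w x)
  (Is : P.-integrable setT (EFin \o dual_weight p w))
  (WSA : forall n, \forall x \ae P,
    cond_exp P (F n) w x * cond_exp P (F n) (dual_weight p w) x `^ (p - 1) <= A)
  (If : P.-integrable setT (EFin \o f))
  (mv : forall n, gmeas (F n) (v n)) (v1 : forall n, \forall x \ae P, `|v n x| <= 1).

Local Notation gT := (gmeas_meas sF Fm).
Local Notation X := (fun i => cond_exp P (F i) f).
Local Notation q := (p / (p - 1)).

(** The factor [18 = 2 * 8 + 2] comes from [sparse_domination], the rest from [sparse_sum_le]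
    without the power of [A]. *)
Definition horizon_const (z : R) : R :=
  18 * (2 * (4 `^ (1 + gap z) * doob_const z (z / (z - 1)))).

Lemma horizon_const_gt0 : 0 < horizon_const p.
Proof.
have [q1 _] := conjugate_exponent p1.
by rewrite !mulr_gt0 ?powR_gt0// doob_const_gt0.
Qed.

Let s0 x : 0 < dual_weight p w x. Proof. by rewrite powR_gt0. Qed.

Let mX i : gmeas (F i) (X i).
Proof. by have [/(measurable_wrtP _ (sF i))] := cond_expP (sF i) (@Fm i) If. Qed.

Let tn n x := `|transform_n P F v f n x|.

Lemma measurable_transform_n n : measurable_fun setT (tn n).
Proof.
rewrite /tn; have -> : (fun x => `|transform_n P F v f n x|) = (fun x => `|mtransform X v n x|).
  by apply/funext => x; rewrite transform_nE.
apply: (gT (n := n)); apply: gmeas_normr.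
exact: (gmeas_mtransform sF Fle mX mv).
Qed.

Lemma measurable_runmax_transform N : measurable_fun setT (fun x => runmax (tn ^~ x) N).
Proof.
elim: N => [|N IH] /=; first exact: measurable_transform_n.
by apply: measurable_maxr => //; exact: measurable_transform_n.
Qed.

(** The shift by [eps] keeps the dominating martingale, and with it the stopping levels, away from
    zero. *)
Lemma runmax_transform_le eps N : 0 < eps ->
  (\int[P]_x (runmax (tn ^~ x) N `^ p * w x)%:E <=
   ((horizon_const p * A `^ (Num.max 1 (p - 1)^-1)) `^ p)%:E *
     \int[P]_x ((`|f x| + eps) `^ p * w x)%:E)%E.
Proof.
move=> eps0; have [q1 pq] := conjugate_exponent p1.
have p0 : 0 < p by move: p1; lra.
have p10 : 0 < p - 1 by move: p1; lra.
pose sigma := dual_weight p w.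
pose h x := `|f x| + eps.
(* The multipliers are bounded by [1] only almost everywhere; clipping makes the bound hold at every
   point. *)
pose v' n x := Num.max (- 1) (Num.min 1 (v n x)).
have mv' n : gmeas (F n) (v' n).
  by apply: measurable_maxr => //; apply: measurable_minr.
have v'1 n x : `|v' n x| <= 1.
  by rewrite ler_norml /v' le_max lexx/= ge_max; apply/andP; split;
    [rewrite (le_trans _ ler01)// oppr_le0|rewrite ge_min lexx].
have v'E n : \forall x \ae P, v' n x = v n x.
  apply: filterS (v1 n) => x; rewrite ler_norml => /andP[vl vu].
  by rewrite /v' (min_idPr vu) (max_idPr vl).
have Ih : P.-integrable setT (EFin \o h).
  have I1 : P.-integrable setT (EFin \o (fun x => `|f x|)) by exact: integrable_norm.
  have I2 : P.-integrable setT (EFin \o cst eps) by exact: finite_measure_integrable_cst.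
  have := integrableD measurableT I1 I2.
  by apply: eq_integrable.
have hf x : `|f x| <= h x by rewrite /h lerDl ltW.
have heps x : eps <= h x by rewrite /h lerDr.
have h0 x : 0 <= h x by rewrite (le_trans _ (heps x))// ltW.
have exH n : exists g : T -> R, [/\ gmeas (F n) g, is_cond_exp P (F n) h g, (forall x, eps <= g x) &
                \forall x \ae P, g x = cond_exp P (F n) h x].
  exact: (cond_exp_ge_version (sF n) (@Fm n)).
have [H HP] := choice exH.
have mH i : gmeas (F i) (H i) by have [] := HP i.
have Hh i : is_cond_exp P (F i) h (H i) by have [] := HP i.
have eH i x : eps <= H i x by have [_ _ /(_ x)] := HP i.
have H0 i x : 0 < H i x by exact: lt_le_trans (eH i x).
have exW n : exists g : T -> R, [/\ gmeas (F n) g, is_cond_exp P (F n) w g, (forall x, 0 < g x) &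
                \forall x \ae P, g x = cond_exp P (F n) w x].
  exact: (cond_exp_gt0_version (sF n) (@Fm n)).
have [W WP] := choice exW.
have mW i : gmeas (F i) (W i) by have [] := WP i.
have wW i : is_cond_exp P (F i) w (W i) by have [] := WP i.
have W0 i x : 0 < W i x by have [_ _ /(_ x)] := WP i.
have exS n : exists g : T -> R, [/\ gmeas (F n) g, is_cond_exp P (F n) sigma g, (forall x, 0 < g x) &
                \forall x \ae P, g x = cond_exp P (F n) sigma x].
  exact: (cond_exp_gt0_version (sF n) (@Fm n)).
have [S SP] := choice exS.
have mS i : gmeas (F i) (S i) by have [] := SP i.
have sS i : is_cond_exp P (F i) sigma (S i) by have [] := SP i.
have S0 i x : 0 < S i x by have [_ _ /(_ x)] := SP i.
have WSA' i : \forall x \ae P, W i x * S i x `^ (p - 1) <= A.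
  have [_ _ _ We] := WP i; have [_ _ _ Se] := SP i.
  by apply: filterS3 We Se (WSA i) => x -> ->.
have Xf i : is_cond_exp P (F i) f (X i) by exact: cond_expP.
have XH i : \forall x \ae P, `|X i x| <= H i x.
  exact: (abs_cond_exp_le (sF i) (@Fm i) If (Xf i) Ih (Hh i) hf).
have sigma_w x : sigma x `^ (1 - p) = w x by exact: dual_powR.
set al := Num.max 1 (p - 1)^-1.
have K0 : 0 < A `^ al by rewrite powR_gt0.
have mw : measurable_fun setT w by exact/measurable_EFinP/(measurable_int P).
have sparse : (\int[P]_x (sparse_sum X v' H N x `^ p * w x)%:E <=
    ((2 * (4 `^ (1 + gap p) * A `^ al * doob_const p q)) `^ p)%:E *
    \int[P]_x (h x `^ p * w x)%:E)%E.
  (* The intermediate weight [rho] is [sigma] in the first case and [w] in the second; the exponent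
     of [A] is [1], respectively [1 / (p - 1)]. *)
  have [p2|p2] := leP 2 p.
    have alE : al = 1 by apply/max_idPl; rewrite invf_le1//; lra.
    have -> : gap p = p - 2 by rewrite /gap p2.
    apply: (@sparse_sum_le _ _ _ P F sF Fm Fle eps X v' H f h eps0 If mX Xf mv' v'1 Ih h0
      mH Hh eH XH w sigma sigma W S S Iw w0 mW wW W0 Is s0 mS sS S0 Is s0 mS sS S0
      p q (p - 2) (A `^ al) p1 q1 pq _ K0 _ sigma_w _ N).
    - lra.
    - move=> x; rewrite dual_mul_powR// /sigma /dual_weight -powRrM.
      by congr (_ `^ _); field; rewrite gt_eqF.
    - move=> i; rewrite alE powRr1 ?(ltW A0)//; apply: filterS (WSA' i) => x.
      exact: Ap_product_ge2.
  have alE : al = (p - 1)^-1 by apply/max_idPr; rewrite invf_ge1//; lra.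
  have -> : gap p = q - 2 by rewrite /gap leNgt p2.
  apply: (@sparse_sum_le _ _ _ P F sF Fm Fle eps X v' H f h eps0 If mX Xf mv' v'1 Ih h0
    mH Hh eH XH w sigma w W S W Iw w0 mW wW W0 Is s0 mS sS S0 Iw w0 mW wW W0
    p q (q - 2) (A `^ al) p1 q1 pq _ K0 _ sigma_w _ N).
  - by rewrite subr_ge0 ler_pdivlMr//; lra.
  - move=> x; rewrite dual_mul_powR//.
    by congr (_ `^ _); field; rewrite gt_eqF.
  - move=> i; rewrite alE; apply: filterS (WSA' i) => x.
    exact: Ap_product_lt2.
have SS0 x : 0 <= sparse_sum X v' H N x by exact: (sparse_sum_ge0 X v' eps0 eH).
have mSS : measurable_fun setT (sparse_sum X v' H N).
  exact: (measurable_sparse_sum sF Fm Fle mX mv' mH).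
have dom : \forall x \ae P, runmax (tn ^~ x) N <= 18 * sparse_sum X v' H N x.
  (* Intersecting countably many almost sure events allows the pathwise bound to be used at all
     times at once. *)
  have /ae_foralln v'E' := v'E; have /ae_foralln XH' := XH.
  apply: filterS2 v'E' XH' => x vE XHx.
  have tE n : transform_n P F v f n x = mtransform X v' n x.
    by rewrite transform_nE; apply: eq_bigr => i _; rewrite vE.
  have le n : tn n x <= 18 * \sum_(i < n.+1) (if stop X v' H i x then H i x else 0).
    rewrite /tn tE.
    have := @sparse_domination _ 8 (mtransform X v' ^~ x) (H ^~ x) _ n _ (fun i => ltW (H0 i x)).
    rewrite (_ : 2 * 8 + 2 = 18 :> R); last by lra.
    apply; first by lra.
      by rewrite /mtransform big_ord0.
    move=> i; rewrite /mtransform big_ord_recr/= addrAC subrr add0r normrM.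
    rewrite (le_trans (_ : _ <= `|X i.+1 x - X i x|)) ?ler_piMl//.
    by rewrite (le_trans (ler_normB _ _))// lerD.
  have mono n m : (n <= m)%N ->
      \sum_(i < n.+1) (if stop X v' H i x then H i x else 0) <=
      \sum_(i < m.+1) (if stop X v' H i x then H i x else 0).
    elim: m => [|m IH]; first by rewrite leqn0 => /eqP ->.
    rewrite leq_eqVlt => /predU1P[->//|/IH /le_trans]; apply.
    rewrite [leRHS]big_ord_recr/= lerDl; case: ifP => // _; exact: ltW.
  have : forall n, (n <= N)%N -> runmax (tn ^~ x) n <= 18 * sparse_sum X v' H N x.
    elim=> [_|n IH nN] /=.
      by apply: (le_trans (le 0%N)); rewrite ler_wpM2l// mono.
    rewrite ge_max IH ?(ltnW nN)//=.
    by apply: (le_trans (le n.+1)); rewrite ler_wpM2l// mono.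
  by move=> /(_ N (leqnn N)).
apply: (@le_trans _ _ (\int[P]_x (18 `^ p * (sparse_sum X v' H N x `^ p * w x))%:E)%E).
  apply: ge0_integral_le.
  - by apply: measurable_funM => //; apply: measurable_funpowR;
      exact: measurable_runmax_transform.
  - by apply: measurable_funM => //; apply: measurable_funM => //; exact: measurable_funpowR.
  - by move=> x; rewrite mulr_ge0 ?powR_ge0// ltW.
  - by move=> x; rewrite mulr_ge0 ?powR_ge0// mulr_ge0 ?powR_ge0// ltW.
  apply: filterS dom => x dx; rewrite mulrA ler_wpM2r ?(ltW (w0 x))// -powRM//.
  rewrite ge0_ler_powR ?nnegrE ?(ltW p0)//.
  - by apply: runmax_ge0 => i; exact: normr_ge0.
  - by rewrite mulr_ge0.
rewrite ge0_integral_mulr ?powR_ge0//; last 2 first.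
- by apply: measurable_funM => //; exact: measurable_funpowR.
- by move=> x; rewrite mulr_ge0 ?powR_ge0// ltW.
apply: (le_trans (lee_wpmul2l _ sparse)); first by rewrite lee_fin powR_ge0.
rewrite muleA -EFinM -powRM//; last first.
  by rewrite !mulr_ge0 ?powR_ge0// ltW// doob_const_gt0.
rewrite /horizon_const le_eqVlt; apply/orP; left; apply/eqP; congr (_ * _)%E.
by congr ((_ `^ _)%:E); ring.
Qed.

End finite_horizon.

(** * Removal of the shift by [eps] *)

Section eps_removal.
Context {R : realType} {d : measure_display} {T : measurableType d}.
Variable P : probability T R.

Lemma powRD_le (p a b : R) : 0 < p -> 0 <= a -> 0 <= b ->
  (a + b) `^ p <= 2 `^ p * (a `^ p + b `^ p).
Proof.
move=> p0 a0 b0; have [ab|ab] := leP a b.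
  apply: (@le_trans _ _ ((2 * b) `^ p)).
    by rewrite ge0_ler_powR ?nnegrE ?addr_ge0 ?mulr_ge0 ?(ltW p0)//; lra.
  by rewrite powRM// ler_wpM2l ?powR_ge0// lerDr powR_ge0.
apply: (@le_trans _ _ ((2 * a) `^ p)).
  by rewrite ge0_ler_powR ?nnegrE ?addr_ge0 ?mulr_ge0 ?(ltW p0)//; lra.
by rewrite powRM// ler_wpM2l ?powR_ge0// lerDl powR_ge0.
Qed.

(** By [powRD_le] the shift separates, at the price of a factor [2], into a term [eps ^ p] times the
    integral of [w], which is finite; so it can be made arbitrarily small. *)
Lemma integral_eps_le (p k : R) (w f : T -> R) (B : \bar R) : 0 < p -> 0 < k ->
  P.-integrable setT (EFin \o w) -> (forall x, 0 <= w x) -> measurable_fun setT f ->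
  (forall eps, 0 < eps ->
    (B <= (k `^ p)%:E * \int[P]_x ((`|f x| + eps) `^ p * w x)%:E)%E) ->
  (B <= ((2 * k) `^ p)%:E * \int[P]_x (`|f x| `^ p * w x)%:E)%E.
Proof.
move=> p0 k0 Iw w0 mf H.
have mw : measurable_fun setT w by exact/measurable_EFinP/(measurable_int P).
have mn : measurable_fun setT (fun x => `|f x|) by exact: measurableT_comp.
have c0 : 0 < (2 * k) `^ p by rewrite powR_gt0// mulr_gt0.
have finw : (\int[P]_x (w x)%:E \is a fin_num)%E by exact: integrable_fin_num.
have W0 : 0 <= fine (\int[P]_x (w x)%:E)%E.
  by apply: fine_ge0; apply: integral_ge0 => x _; rewrite lee_fin.
have split eps : 0 < eps -> (B <= ((2 * k) `^ p)%:E *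
    (\int[P]_x (`|f x| `^ p * w x)%:E + (eps `^ p * fine (\int[P]_x (w x)%:E))%:E))%E.
  move=> eps0; apply: (le_trans (H _ eps0)).
  rewrite powRM ?(ltW k0)// mulrC EFinM -muleA lee_pmul2l ?lte_fin ?powR_gt0//.
  rewrite EFinM fineK// -ge0_integral_mulr ?powR_ge0//.
  rewrite -ge0_integral_add//; last 4 first.
  - by apply: measurable_funM => //; exact: measurable_funpowR.
  - exact: measurable_funM.
  - by move=> x; rewrite mulr_ge0 ?powR_ge0.
  - by move=> x; rewrite mulr_ge0 ?powR_ge0.
  have me : measurable_fun setT (fun x => `|f x| `^ p * w x + eps `^ p * w x).
    apply: measurable_funD; apply: measurable_funM => //; exact: measurable_funpowR.
  have e0 x : 0 <= `|f x| `^ p * w x + eps `^ p * w x.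
    by rewrite addr_ge0// mulr_ge0 ?powR_ge0.
  rewrite -ge0_integral_mulr ?powR_ge0//.
  apply: ge0_integral_le => //.
  - apply: measurable_funM => //; apply: measurable_funpowR.
    exact: measurable_funD.
  - exact: measurable_funM.
  - by move=> x; rewrite mulr_ge0 ?powR_ge0.
  - by move=> x; rewrite mulr_ge0 ?powR_ge0.
  apply: aeW => x; rewrite -mulrDl mulrA ler_wpM2r//.
  by apply: powRD_le => //; exact: ltW.
have : (0 <= \int[P]_x (`|f x| `^ p * w x)%:E)%E.
  by apply: integral_ge0 => x _; rewrite lee_fin mulr_ge0 ?powR_ge0.
move: split; case: (\int[P]_x (`|f x| `^ p * w x)%:E)%E => [J| |]//; last first.
  by move=> _ _; rewrite gt0_muley ?leey.
set W := fine _ in W0 *; set c := (2 * k) `^ p in c0 * => split _.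
apply/lee_addgt0Pr => dl dl0.
have D0 : 0 < c * W + 1 by rewrite ltr_wpDl// mulr_ge0// ltW.
have E0 : 0 < dl / (c * W + 1) by rewrite divr_gt0.
(* This [eps] makes the extra term at most [dl]; the [1] in the denominator avoids a division by
   zero. *)
apply: (le_trans (split ((dl / (c * W + 1)) `^ p^-1) _)); first by rewrite powR_gt0.
rewrite -powRrM mulVf ?gt_eqF// powRr1 ?(ltW E0)//.
rewrite -EFinD -!EFinM -EFinD lee_fin mulrDr lerD2l mulrCA -mulrA ler_piMr ?(ltW dl0)//.
by rewrite mulrC ler_pdivrMr// mul1r lerDl.
Qed.

End eps_removal.

(** * Passage to infinite time and to weighted norms *)

Theorem theorem1p4 (R : realType) (p : R) (hp : 1 < p) :
  exists2 C : R, 0 < C &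
  forall (d : measure_display) (T : measurableType d) (P : probability T R)
         (F : nat -> set (set T)) (w f : T -> R) (v : nat -> T -> R),
    filtered_probability_space P F ->
    is_weight P w -> in_Ap P F p w ->
    P.-integrable setT (EFin \o f) ->
    adapted F v ->
    (ereal_sup (range (fun n => Lnorm P +oo (EFin \o v n))) <= 1)%E ->
    (wLnorm P p w (EFin \o transform P F v f)
       <= C%:E * Ap_const P F p w `^ (Num.max 1 (p - 1)^-1)%R
          * wLnorm P p w (EFin \o f))%E
    /\
    (wLnorm P p w (transform_max P F v f)
       <= C%:E * Ap_const P F p w `^ (Num.max 1 (p - 1)^-1)%R
          * wLnorm P p w (EFin \o f))%E.
Proof.
have p0 : 0 < p by lra.
(* The factor [2] is the cost of [integral_eps_le]. *)
exists (2 * horizon_const p); first by rewrite mulr_gt0// horizon_const_gt0.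
move=> d T P F w f v [_ [sF Fm] Fle _ _] [w0 Iw] [Is Apoo] If av v1.
have PT : (0 < P [set: T])%E by rewrite probability_setT.
have Lnormoo (g : T -> \bar R) : Lnorm P +oo g = ess_sup P (abse \o g).
  by rewrite unlock PT.
have Ap0 : (0 <= Ap_const P F p w)%E.
  apply: ereal_sup_ge; exists (Lnorm P +oo (fun x => (cond_exp P (F 0%N) w x *
    cond_exp P (F 0%N) (dual_weight p w) x `^ (p - 1))%:E)); first by exists 0%N.
  exact: Lnorm_ge0.
have [A ApE] : exists A, Ap_const P F p w = A%:E.
  by exists (fine (Ap_const P F p w)); rewrite fineK// ge0_fin_numE.
have WSA n : \forall x \ae P,
    cond_exp P (F n) w x * cond_exp P (F n) (dual_weight p w) x `^ (p - 1) <= A.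
  have : (Lnorm P +oo (fun x => (cond_exp P (F n) w x *
      cond_exp P (F n) (dual_weight p w) x `^ (p - 1))%:E) <= A%:E)%E.
    by rewrite -ApE; apply: ereal_sup_ubound; exists n.
  rewrite Lnormoo => /ess_supP; apply: filterS => x /=.
  by rewrite lee_fin; apply: le_trans; exact: ler_norm.
have vn1 n : \forall x \ae P, `|v n x| <= 1.
  have : (Lnorm P +oo (EFin \o v n) <= 1)%E.
    by apply: le_trans v1; apply: ereal_sup_ubound; exists n.
  by rewrite Lnormoo => /ess_supP; apply: filterS => x /=; rewrite lee_fin.
have s0 x : 0 < dual_weight p w x by rewrite powR_gt0.
(* The [A_p] product at time [0] is almost surely positive and at most [A], and an almost sure event
   of a probability space has a point. *)
have A0 : 0 < A.
  have aeA : \forall x \ae P, 0 < A.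
    have gW := cond_exp_gt0 (sF 0%N) (Fm 0%N) Iw (cond_expP (sF 0%N) (Fm 0%N) Iw) w0.
    have gS := cond_exp_gt0 (sF 0%N) (Fm 0%N) Is (cond_expP (sF 0%N) (Fm 0%N) Is) s0.
    apply: filterS3 gW gS (WSA 0%N) => x Wx Sx; apply: lt_le_trans.
    by rewrite mulr_gt0// powR_gt0.
  have aeP := ae_properfilter_algebraOfSetsType PT.
  by have [x] := filter_ex aeA.
have mv n : gmeas (F n) (v n) by exact/measurable_wrtP.
have mf : measurable_fun setT f by exact/measurable_EFinP/(measurable_int P).
set al := Num.max 1 (p - 1)^-1.
have A1 : 0 < A `^ al by rewrite powR_gt0.
have h0 := horizon_const_gt0 hp.
pose J := (\int[P]_x (`|f x| `^ p * w x)%:E)%E.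
have J0 : (0 <= J)%E.
  by apply: integral_ge0 => x _; rewrite lee_fin mulr_ge0 ?powR_ge0// ltW.
have bound N : (\int[P]_x (runmax (fun n => `|transform_n P F v f n x|) N `^ p * w x)%:E <=
    ((2 * (horizon_const p * A `^ al)) `^ p)%:E * J)%E.
  apply: integral_eps_le => //; first by rewrite mulr_gt0.
    by move=> x; exact: ltW.
  by move=> eps eps0; exact: runmax_transform_le.
pose u N x := (runmax (fun n => `|transform_n P F v f n x|) N `^ p * w x)%:E.
have mw : measurable_fun setT w by exact/measurable_EFinP/(measurable_int P).
have rm0 N x : 0 <= runmax (fun n => `|transform_n P F v f n x|) N by exact: runmax_ge0.
have mu N : measurable_fun setT (u N).
  apply/measurable_EFinP/measurable_funM => //; apply: measurable_funpowR.
  exact: (measurable_runmax_transform sF Fm Fle If mv).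
have u0 N x : setT x -> (0 <= u N x)%E.
  by move=> _; rewrite lee_fin mulr_ge0 ?powR_ge0// ltW.
have ndu x : setT x -> {homo u ^~ x : n m / (n <= m)%N >-> (n <= m)%E}.
  move=> _; apply: homo_leq => [//|a b c|N]; first exact: le_trans.
  rewrite lee_fin ler_wpM2r ?(ltW (w0 x))// ge0_ler_powR ?nnegrE ?(ltW p0)//.
  by rewrite /= le_max lexx.
(* Monotone convergence in [N]: the bound for the running maxima is uniform in [N]. *)
have Mbound : (\int[P]_x (`|transform_max P F v f x| `^ p * (w x)%:E) <=
    ((2 * (horizon_const p * A `^ al)) `^ p)%:E * J)%E.
  apply: (@le_trans _ _ (\int[P]_x limn (u ^~ x))%E).
    apply: ge0_le_integralT => x.
      by rewrite mule_ge0 ?poweR_ge0// lee_fin ltW.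
    rewrite (cvg_lim _ (ereal_nondecreasing_cvgn (ndu x Logic.I)))//.
    exact: transform_max_powR.
  rewrite monotone_convergence//; apply: lime_le.
    by apply/cvg_ex; eexists; exact: (@cvg_monotone_convergence _ _ _ P _ measurableT _ mu u0 ndu).
  by near=> N; exact: bound.
have wf : wLnorm P p w (EFin \o f) = (J `^ p^-1)%E.
  by rewrite /wLnorm; congr (_ `^ _)%E; apply: eq_integral => x _;
     rewrite /= poweR_EFin -EFinM.
(* Taking [p]-th roots turns the integral bound into the norm bound, for both functions alike. *)
have final (I : \bar R) : (0 <= I)%E ->
    (I <= ((2 * (horizon_const p * A `^ al)) `^ p)%:E * J)%E ->
    (I `^ p^-1 <= (2 * horizon_const p)%:E * Ap_const P F p w `^ al * J `^ p^-1)%E.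
  move=> I0 IJ.
  have c0 : 0 <= 2 * (horizon_const p * A `^ al) by rewrite mulr_ge0// mulr_ge0 ?ltW.
  have rhs0 : (0 <= ((2 * (horizon_const p * A `^ al)) `^ p)%:E * J)%E.
    by rewrite mule_ge0// lee_fin powR_ge0.
  have pV0 : 0 <= p^-1 by rewrite invr_ge0 ltW.
  apply: (le_trans (gt0_ler_poweR pV0 _ _ IJ)); rewrite ?in_itv/= ?I0 ?rhs0 ?leey//.
  rewrite poweRM// ?lee_fin ?powR_ge0// poweR_EFin -powRrM divff ?gt_eqF// powRr1//.
  by rewrite ApE poweR_EFin -EFinM mulrA.
rewrite wf; split; apply: final => //; try exact: integral_ge0.
- by apply: integral_ge0 => x _; rewrite mule_ge0 ?poweR_ge0// lee_fin ltW.
(* The bound for [Tf] follows from the one for [M(Tf)] by pointwise comparison. *)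
- apply: le_trans Mbound; apply: ge0_le_integralT => x.
    by rewrite mule_ge0 ?poweR_ge0// lee_fin ltW.
  rewrite lee_wpmul2r ?lee_fin ?(ltW (w0 x))// gt0_ler_poweR ?(ltW p0)//.
  - by rewrite in_itv/= lee_fin normr_ge0 leey.
  - by rewrite in_itv/= abse_ge0 leey.
  - by rewrite [leRHS]gee0_abs ?transform_max_ge0//; exact: transform_le_max.
- by apply: integral_ge0 => x _; rewrite mule_ge0 ?poweR_ge0// lee_fin ltW.
Unshelve. all: by end_near. Qed.
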